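(* For long virtual knots, both in the framed and in the unframed category, the ordered polynomial invariant $\overline{p}_t$ is stronger than the polynomial invariant $p_t$: if $\overline{p}_t(K)=\overline{p}_t(K')$ then $p_t(K)=p_t(K')$, and there exist long virtual knots $K_1,K_2$ with $p_t(K_1)=p_t(K_2)$ but $\overline{p}_t(K_1)\neq\overline{p}_t(K_2)$.
   Context: A long virtual knot diagram is an immersion $\mathbb{R}\to\mathbb{R}^2$ which coincides with the $x$-axis outside some closed ball centered at the origin and whose double points are decorated either as classical crossings (with over/under information, hence a sign $\mathrm{sgn}=\pm1$) or as virtual crossings. Long virtual knots (unframed) are diagrams modulo the classical Reidemeister moves 1, 2, 3, the purely virtual Reidemeister moves 1, 2, 3, and the mixed move (sliding an arc carrying only virtual crossings past a classical crossing). Framed long virtual knots are defined in the same way, except that classical Reidemeister move 1 is replaced by the framed Reidemeister move 1, which inserts or removes on an arc two consecutive kinks whose classical crossings have opposite signs. For a classical crossing $d$ of $K$, smooth $d$ according to orientation to obtain a two-component virtual tangle (one long component and one closed component), and forget the over/under information. Let component 1 be the long component and component 2 the closed component. For a classical crossing $x$ between the two components ($x\in1\cap2$) let $\mathrm{sgn}(x)=+1$ if the tangent vectors at $x$ (of component 1, of component 2), in this order, form a positively oriented basis of the plane, and $-1$ otherwise. The intersection index is $i(d)=\sum_{x\in1\cap2}\mathrm{sgn}(x)$. Summing over all classical crossings $d$ of $K$: in the unframed case $p_t(K)=\sum_d\mathrm{sgn}(d)(t^{|i(d)|}-1)$ and $\overline p_t(K)=\sum_d\mathrm{sgn}(d)(t^{i(d)}-1)$;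 in the framed case $p_t(K)=\sum_d\mathrm{sgn}(d)t^{|i(d)|}$ and $\overline p_t(K)=\sum_d\mathrm{sgn}(d)t^{i(d)}$. These are invariants of long virtual knots in the respective category, with values in $\mathbb{Z}[t]$ and $\mathbb{Z}[t,t^{-1}]$ respectively. *)

(* Defs.v *)
From HB Require Import structures.
From Stdlib Require Import Relation_Operators.
From mathcomp Require Import all_boot all_order all_algebra fraction.
From mathcomp Require Import all_classical all_reals all_analysis.

Set Implicit Arguments.
Unset Strict Implicit.
Unset Printing Implicit Defensive.

Import Order.TTheory GRing.Theory Num.Theory.
Import numFieldNormedType.Exports.

Local Open Scope classical_set_scope.
Local Open Scope ring_scope.

(** * Long virtual knot diagrams *)

Definition det2 (R : realType) (u v : R * R) : R := u.1 * v.2 - u.2 * v.1.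

Definition smooth_curve (R : realType) (g : R -> R * R) : Prop :=
  forall (n : nat) (t : R), derivable (derive1n n g) t 1.

(* A double point is recorded by its two parameters, the smaller one first. *)
Definition double_points (R : realType) (g : R -> R * R) : set (R * R) :=
  [set d | d.1 < d.2 /\ g d.1 = g d.2].

(* For a classical crossing the decoration tells which of the two passages of
   the curve through the double point, in the order of the parameter, is the
   overpass. *)
Inductive decoration := Virtual | FirstOver | SecondOver.

Definition classical (k : decoration) : bool :=
  if k is Virtual then false else true.

(* The decoration is a total function on pairs of parameters; only its values
   at the double points matter, see [isotopic]. *)
Record diagram (R : realType) := Diagram {
  curve : R -> R * R;
  deco : R * R -> decoration;
  curve_smooth : smooth_curve curve;
  curve_immersion : forall t, derive1 curve t != (0, 0);
  curve_long : exists r : R, forall t, r < `|t| -> curve t = (t, 0);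
  curve_finite : finite_set (double_points curve);
  curve_transverse : forall d, double_points curve d ->
    det2 (derive1 curve d.1) (derive1 curve d.2) != 0;
  curve_no_triple : forall d e, double_points curve d ->
    double_points curve e -> curve d.1 = curve e.1 -> d = e }.

Section Crossings.
Variables (R : realType) (D : diagram R).
Implicit Types d x : R * R.

Definition classical_crossings : set (R * R) :=
  [set d | double_points (curve D) d /\ classical (deco D d)].

Definition orientation (s t : R) : int :=
  sgz (det2 (derive1 (curve D) s) (derive1 (curve D) t)).

(* A crossing is positive when (overpassing tangent, underpassing tangent) is a
   positively oriented basis of the plane. *)
Definition crossing_sign d : int :=
  match deco D d with
  | FirstOver => orientation d.1 d.2
  | SecondOver => orientation d.2 d.1
  | Virtual => 0
  end.

(* The oriented smoothing at d splits off the closed component 2, traced by the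
   parameters between d.1 and d.2; the other parameters trace component 1. *)
Definition on_closed d (t : R) : bool := d.1 < t < d.2.

Definition mixed_crossings d : set (R * R) :=
  [set x | classical_crossings x /\ on_closed d x.1 != on_closed d x.2].

Definition intersection_sign d x : int :=
  if on_closed d x.1 then orientation x.2 x.1 else orientation x.1 x.2.

Definition intersection_index d : int :=
  \sum_(x \in mixed_crossings d) intersection_sign d x.

End Crossings.

(** * Planar isotopy *)

Fixpoint Ck (R : realType) (V W : normedModType R) (n : nat) (f : V -> W)
    : Prop :=
  if n is m.+1 then
    (forall p, differentiable f p) /\ (forall v, Ck m (fun p => 'D_v f p))
  else continuous f.

(* Compactly supported orientation preserving diffeomorphisms of the plane; all
   of them are isotopic to the identity. *)
Definition plane_diffeo (R : realType) (F : R * R -> R * R) : Prop :=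
  [/\ exists2 G : R * R -> R * R,
        (forall n, Ck n F /\ Ck n G) & cancel F G /\ cancel G F,
      forall p, 0 < det2 ('D_((1 : R), (0 : R)) F p) ('D_((0 : R), (1 : R)) F p)
    & exists r : R, forall p, r < `|p| -> F p = p].

Definition line_diffeo (R : realType) (h : R -> R) : Prop :=
  [/\ forall n t, derivable (derive1n n h) t 1, forall t, 0 < derive1 h t
    & bijective h].

Definition isotopic (R : realType) (D D' : diagram R) : Prop :=
  exists F h, [/\ plane_diffeo F, line_diffeo h,
    forall t, curve D' t = F (curve D (h t))
  & forall d, double_points (curve D') d ->
      deco D' d = deco D (h d.1, h d.2)].

(** * Reidemeister moves

   A move replaces the part of a diagram lying in a round disc (every embedded
   disc can be made round by a planar isotopy).  The strands of the diagram in
   the disc are given by disjoint intervals of parameters, listed from left to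
   right. *)

Definition disc (R : realType) (c : R * R) (r : R) : set (R * R) :=
  [set p | (p.1 - c.1) ^+ 2 + (p.2 - c.2) ^+ 2 <= r ^+ 2].

Definition on_strand (R : realType) (a : R * R) (t : R) : bool :=
  a.1 <= t <= a.2.

Definition on_strands (R : realType) (s : seq (R * R)) (t : R) : bool :=
  has (fun a => on_strand a t) s.

Definition same_outside (R : realType) (s : seq (R * R)) (D D' : diagram R)
    : Prop :=
  [/\ sorted <%R (flatten [seq [:: a.1; a.2] | a <- s]),
      exists c r, 0 < r /\ forall t,
        (on_strands s t <-> disc c r (curve D t)) /\
        (on_strands s t <-> disc c r (curve D' t)),
      forall t, ~~ on_strands s t -> curve D t = curve D' t
    & forall d, double_points (curve D) d -> ~~ on_strands s d.1 ->
        deco D d = deco D' d].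

Definition inner_crossings (R : realType) (s : seq (R * R)) (D : diagram R)
    : set (R * R) :=
  [set d | double_points (curve D) d /\ on_strands s d.1].

Definition between (R : realType) (a b d : R * R) : bool :=
  on_strand a d.1 && on_strand b d.2.

(* A kink, with a classical or a virtual crossing, is inserted on an arc. *)
Definition move1 (R : realType) (is_classical : bool) (D D' : diagram R)
    : Prop :=
  exists a d, [/\ same_outside [:: a] D D',
    inner_crossings [:: a] D = set0,
    inner_crossings [:: a] D' = [set d]
  & classical (deco D' d) = is_classical].

(* Two consecutive kinks with opposite signs are inserted on an arc. *)
Definition framed_move1 (R : realType) (D D' : diagram R) : Prop :=
  exists a d e, [/\ same_outside [:: a] D D',
    inner_crossings [:: a] D = set0,
    inner_crossings [:: a] D' = [set d; e] /\ d.2 < e.1,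
    classical (deco D' d) /\ classical (deco D' e)
  & crossing_sign D' d = - crossing_sign D' e].

(* Two disjoint arcs are made to cross twice.  Equality of the decorations
   covers the classical move (the same arc is over at both crossings) and the
   virtual one.  As the arcs can be made disjoint inside the disc, their
   crossings automatically have opposite orientations. *)
Definition move2 (R : realType) (D D' : diagram R) : Prop :=
  exists a b d e, [/\ same_outside [:: a; b] D D',
    inner_crossings [:: a; b] D = set0,
    inner_crossings [:: a; b] D' = [set d; e] /\ d <> e,
    between a b d /\ between a b e
  & deco D' d = deco D' e /\
    orientation D' d.1 d.2 = - orientation D' e.1 e.2].

(* Decorations k12, k13, k23 of three arcs 1, 2, 3 allowed in the third move:
   all classical and not cyclic (one arc over both others, one under both
   others), all virtual, or a single classical crossing (mixed move). *)
Definition move3_decoration (k12 k13 k23 : decoration) : bool :=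
  match k12, k13, k23 with
  | Virtual, Virtual, _ | Virtual, _, Virtual | _, Virtual, Virtual => true
  | Virtual, _, _ | _, Virtual, _ | _, _, Virtual => false
  | FirstOver, SecondOver, FirstOver => false
  | SecondOver, FirstOver, SecondOver => false
  | _, _, _ => true
  end.

(* Three arcs in a disc, any two of them crossing once at c12, c13, c23, bound a
   triangle and cross like three oriented straight lines.  The orders of the
   crossings along the arcs are then related to their orientations as for such
   lines.  This is automatic for curves in the plane, and only makes explicit
   what one reads off the usual picture of the move. *)
Definition triangle (R : realType) (D : diagram R) (c12 c13 c23 : R * R)
    : Prop :=
  let o1 := c12.1 < c13.1 in
  let o2 := c12.2 < c23.1 in
  let o3 := c13.2 < c23.2 in
  let w12 := orientation D c12.1 c12.2 in
  let w13 := orientation D c13.1 c13.2 in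
  let w23 := orientation D c23.1 c23.2 in
  [/\ (o1 == o2) = (w13 == w23),
      (o2 == o3) = (w12 == w13) & (o1 == o3) = (w12 == w23)].

(* One of three pairwise crossing arcs is pushed across the crossing of the two
   others: the order of the two crossings is reversed along each arc, while the
   orientation and the decoration of each crossing are unchanged. *)
Definition move3 (R : realType) (D D' : diagram R) : Prop :=
  exists a1 a2 a3 c12 c13 c23 c12' c13' c23',
  [/\ same_outside [:: a1; a2; a3] D D',
      inner_crossings [:: a1; a2; a3] D = [set c12; c13; c23] /\
      inner_crossings [:: a1; a2; a3] D' = [set c12'; c13'; c23'],
      [/\ between a1 a2 c12, between a1 a3 c13 & between a2 a3 c23] /\
      [/\ between a1 a2 c12', between a1 a3 c13' & between a2 a3 c23'],
      [/\ (c12'.1 < c13'.1) = ~~ (c12.1 < c13.1),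
          (c12'.2 < c23'.1) = ~~ (c12.2 < c23.1),
          (c13'.2 < c23'.2) = ~~ (c13.2 < c23.2) & triangle D c12 c13 c23]
    & [/\ move3_decoration (deco D c12) (deco D c13) (deco D c23),
          [/\ deco D' c12' = deco D c12, deco D' c13' = deco D c13
            & deco D' c23' = deco D c23]
        & [/\ orientation D' c12'.1 c12'.2 = orientation D c12.1 c12.2,
              orientation D' c13'.1 c13'.2 = orientation D c13.1 c13.2
            & orientation D' c23'.1 c23'.2 = orientation D c23.1 c23.2]]].

(** * Long virtual knots and their polynomials *)

Inductive category := Unframed | Framed.

Definition classical_move1 (R : realType) (c : category) :
    diagram R -> diagram R -> Prop :=
  if c is Unframed then move1 true else @framed_move1 R.

Definition move (R : realType) (c : category) (D D' : diagram R) : Prop :=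
  isotopic D D' \/ classical_move1 c D D' \/ move1 false D D' \/
  move2 D D' \/ move3 D D'.

Definition equivalent (R : realType) (c : category) :
    diagram R -> diagram R -> Prop :=
  clos_refl_sym_trans (diagram R) (move c).

Record long_virtual_knot (R : realType) (c : category) := LongVirtualKnot {
  diagrams : set (diagram R);
  diagrams_class : exists D, diagrams = [set D' | equivalent c D D'] }.

Definition poly_term (c : category) (i : int) : {poly int} :=
  if c is Unframed then 'X^(`|i|%N) - 1 else 'X^(`|i|%N).

Definition diagram_poly (R : realType) (c : category) (D : diagram R)
    : {poly int} :=
  \sum_(d \in classical_crossings D)
    poly_term c (intersection_index D d) *~ crossing_sign D d.

(* The ring of Laurent polynomials Z[t, t^-1] is regarded as a subring of the
   field of fractions of Z[t]. *)
Definition laurent_t : {fraction {poly int}} := tofrac 'X.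

Definition ordered_poly_term (c : category) (i : int)
    : {fraction {poly int}} :=
  if c is Unframed then laurent_t ^ i - 1 else laurent_t ^ i.

Definition diagram_ordered_poly (R : realType) (c : category) (D : diagram R)
    : {fraction {poly int}} :=
  \sum_(d \in classical_crossings D)
    ordered_poly_term c (intersection_index D d) *~ crossing_sign D d.

(* The common value of f on all the diagrams of a knot; x0 is a dummy, returned
   if f were not constant on them. *)
Definition knot_value (T : choiceType) (x0 : T) (R : realType) (c : category)
    (f : diagram R -> T) (K : long_virtual_knot R c) : T :=
  xget x0 [set P | forall D, diagrams K D -> f D = P].

Definition knot_poly (R : realType) (c : category) (K : long_virtual_knot R c)
    : {poly int} :=
  knot_value 0 (diagram_poly c) K.

Definition knot_ordered_poly (R : realType) (c : category)
    (K : long_virtual_knot R c) : {fraction {poly int}} :=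
  knot_value 0 (diagram_ordered_poly c) K.

(* Main.v *)
From HB Require Import structures.
Require Import Defs.
From Stdlib Require Import Relation_Operators.
From mathcomp Require Import all_boot all_order all_algebra fraction.
From mathcomp Require Import all_classical all_reals all_analysis.
From mathcomp Require Import ring lra zify.

Set Implicit Arguments.
Unset Strict Implicit.
Unset Printing Implicit Defensive.

Import Order.TTheory GRing.Theory Num.Theory.
Import numFieldNormedType.Exports.

Local Open Scope classical_set_scope.
Local Open Scope ring_scope.

(* Give a classical crossing x the weight orientation x.1 x.2 and a virtual one
   the weight 0; then i(d) is the sum over x of the weight of x times
   ([x.2 on 2] - [x.1 on 2]), where 2 is the closed component at d.  A move
   splits the crossings into those outside the disc, which are common to both
   diagrams, and those inside, for which the sums are compared directly.  This
   makes both polynomials invariant, and the linear map t^i |-> t^|i| sends the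
   ordered one to the other.

   They are separated by a trefoil-shaped curve with Gauss code C A B C A B, in
   which A is virtual and C and B are classical of opposite signs: the indices
   of C and B are 1 and -1, so that the ordered polynomial is t^-1 - t and the
   other one 0, as for the diagram where all the crossings are virtual. *)

(** * Indices as sums over all double points *)

Section ChordSum.
Variables (R : realType) (D : diagram R).
Implicit Types (d x : R * R) (s t : R).

Lemma det2C (u v : R * R) : det2 v u = - det2 u v.
Proof. by rewrite /det2; ring. Qed.

Lemma orientationC s t : orientation D t s = - orientation D s t.
Proof. by rewrite /orientation det2C sgzN. Qed.

(* Virtual crossings get weight 0, so that all sums below can be taken over all
   double points. *)
Definition weight x : int :=
  if classical (deco D x) then orientation D x.1 x.2 else 0.

Definition link d x : int :=
  ((on_closed d x.2)%:Z - (on_closed d x.1)%:Z) * weight x.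

(** If exactly one passage through [x] lies on the closed component, the difference in [link] is 1
    or -1 and accounts for the order of the two tangents; otherwise it is 0, which allows the sum to
    be widened. *)
Lemma intersection_indexE d :
  intersection_index D d = \sum_(x \in double_points (curve D)) link d x.
Proof.
rewrite /intersection_index.
rewrite (eq_fsbigr (link d)); last first.
  move=> x; rewrite inE => -[[_ cx] mx].
  rewrite /intersection_sign /link /weight cx orientationC.
  by case: (on_closed d x.1) mx; case: (on_closed d x.2) => //= _; ring.
apply: fsbig_widen => [x [[]]//|x [dx nx]] /=.
rewrite /link /weight; case: ifP => cx; last by rewrite mulr0.
suff -> : on_closed d x.1 = on_closed d x.2 by rewrite subrr mul0r.
by apply: contrapT => /eqP ne; apply: nx; split.
Qed.

(** With [T] left arbitrary, both polynomials are instances, so that invariance is proved once for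
    the two. *)
Definition chord_sum (V : zmodType) (T : int -> V) : V :=
  \sum_(d \in double_points (curve D))
    T (intersection_index D d) *~ crossing_sign D d.

Lemma classical_chord_sum (V : zmodType) (T : int -> V) :
  \sum_(d \in classical_crossings D)
    T (intersection_index D d) *~ crossing_sign D d = chord_sum T.
Proof.
apply: fsbig_widen => [x []//|x [dx nx]] /=.
suff -> : crossing_sign D x = 0 by rewrite mulr0z.
rewrite /crossing_sign; case k : (deco D x) => //; exfalso; apply: nx;
by split => //; rewrite k.
Qed.

Lemma double_point_eq d e : double_points (curve D) d ->
  double_points (curve D) e -> curve D d.1 = curve D e.1 -> d = e.
Proof. exact: curve_no_triple. Qed.

(** A shared parameter would put both double points at the same point of the plane, against the
    absence of triple points. *)
Lemma double_point_neq d e : double_points (curve D) d ->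
  double_points (curve D) e -> d <> e ->
  [/\ d.1 != e.1, d.1 != e.2, d.2 != e.1 & d.2 != e.2].
Proof.
move=> dd de ne; have [_ ed] := dd; have [_ ee] := de.
by split; apply/eqP => h; apply: ne; apply: double_point_eq => //;
  [rewrite h|rewrite h ee|rewrite ed h|rewrite ed ee h].
Qed.

Lemma link_self d : link d d = 0.
Proof. by rewrite /link /on_closed !ltxx andbF subrr mul0r. Qed.

Lemma orientation_double_point d : double_points (curve D) d ->
  orientation D d.1 d.2 = 1 \/ orientation D d.1 d.2 = - 1.
Proof.
move=> /curve_transverse; rewrite /orientation; case: sgzP; [by []|by left|by right].
Qed.

End ChordSum.

(** * What a move leaves unchanged outside its disc *)

Section SameOutside.
Variables (R : realType) (s : seq (R * R)).
Implicit Types (D : diagram R) (d x : R * R) (t u : R).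

(** Lying on a strand depends only on whether the image point is in the disc, and both parameters
    have the same image. *)
Lemma on_strands_double_point D D' d : same_outside s D D' ->
  double_points (curve D) d -> on_strands s d.1 = on_strands s d.2.
Proof.
move=> [_ [c [r [_ H]]] _ _] [_ e].
by apply/idP/idP => /(H _).1; rewrite ?e => h; apply/(H _).1; rewrite ?e.
Qed.

Lemma same_outside_sym D D' : same_outside s D D' -> same_outside s D' D.
Proof.
move=> so; have [so1 [c [r [r0 H]]] cc dd] := so; split => //.
- exists c, r; split => // t; have [] := H t; tauto.
- by move=> t /cc.
move=> d [d12 e] nd; rewrite dd//; split => //.
rewrite !cc//.
apply: contra nd => /(H _).2; rewrite -e => h; exact/(H _).2.
Qed.

Lemma outer_double_point D D' d : same_outside s D D' ->
  double_points (curve D) d -> ~~ on_strands s d.1 ->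
  double_points (curve D') d.
Proof.
move=> so dd nd; have [d12 e] := dd; split => //.
have nd2 : ~~ on_strands s d.2 by rewrite -(on_strands_double_point so dd).
by have [_ _ cc _] := so; rewrite -!cc.
Qed.

(** The strands are finitely many closed intervals. Openness of their complement lets tangent
    vectors, and not only points, be compared off the strands. *)
Lemma near_off_strands t : ~~ on_strands s t ->
  \forall u \near t, ~~ on_strands s u.
Proof.
elim: s => [|a l IH] /=; first by move=> _; near=> u.
rewrite negb_or => /andP[na nl].
have h1 := IH nl.
have h2 : \forall u \near t, ~~ on_strand a u.
  move: na; rewrite /on_strand negb_and -!ltNge => /orP[h|h].
    near=> u; rewrite negb_and -!ltNge; apply/orP; left.
    by near: u; apply: lt_nbhsl.
  near=> u; rewrite negb_and -!ltNge; apply/orP; right.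
  by near: u; apply: lt_nbhsr.
near=> u; rewrite negb_or; apply/andP; split; near: u => //.
Unshelve. all: by end_near. Qed.

Lemma orientation_outside D D' t u : same_outside s D D' ->
  ~~ on_strands s t -> ~~ on_strands s u ->
  orientation D t u = orientation D' t u.
Proof.
move=> so; have [_ _ cc _] := so.
have E v : ~~ on_strands s v -> derive1 (curve D) v = derive1 (curve D') v.
  move=> nv; rewrite !derive1E; apply: near_eq_derive.
  near=> w; apply: cc; near: w; exact: near_off_strands.
by move=> nt nu; rewrite /orientation !E.
Unshelve. all: by end_near. Qed.

Definition outer_crossings D : set (R * R) :=
  [set d | double_points (curve D) d /\ ~~ on_strands s d.1].

Lemma outer_crossingsE D D' : same_outside s D D' ->
  outer_crossings D = outer_crossings D'.
Proof.
move=> so; apply/seteqP; split => d [dd nd]; split => //.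
  exact: outer_double_point so dd nd.
exact: outer_double_point (same_outside_sym so) dd nd.
Qed.

Lemma finite_outer D : finite_set (outer_crossings D).
Proof. by apply: sub_finite_set (curve_finite D) => d []. Qed.

Lemma finite_inner D : finite_set (inner_crossings s D).
Proof. by apply: sub_finite_set (curve_finite D) => d []. Qed.

Lemma split_crossings (V : zmodType) D (F : R * R -> V) :
  \sum_(d \in double_points (curve D)) F d =
  \sum_(d \in outer_crossings D) F d + \sum_(d \in inner_crossings s D) F d.
Proof.
rewrite -fsbigU0 //; [|exact: finite_outer|exact: finite_inner|]; last first.
  by move=> d [[_ /negP nd] [_ id]].
apply: eq_fsbigl.
apply/seteqP; split => [d dd|d [][]//].
by have [h|h] := boolP (on_strands s d.1); [right|left].
Qed.

Lemma weight_outside D D' x : same_outside s D D' ->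
  outer_crossings D x -> weight D x = weight D' x.
Proof.
move=> so [dx nx]; have [_ _ _ dd] := so.
have nx2 : ~~ on_strands s x.2 by rewrite -(on_strands_double_point so dx).
by rewrite /weight (dd x dx nx) (orientation_outside so nx nx2).
Qed.

Lemma sign_outside D D' x : same_outside s D D' ->
  outer_crossings D x -> crossing_sign D x = crossing_sign D' x.
Proof.
move=> so [dx nx]; have [_ _ _ dd] := so.
have nx2 : ~~ on_strands s x.2 by rewrite -(on_strands_double_point so dx).
rewrite /crossing_sign (dd x dx nx) (orientation_outside so nx nx2).
by rewrite (orientation_outside so nx2 nx).
Qed.

(** Outer crossings keep their signs and their links with each other. A move is therefore checked on
    inner crossings only: on their total link with each outer chord, and on their own terms of the
    sum. *)
Lemma chord_sum_move (V : zmodType) (T : int -> V) D D' :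
  same_outside s D D' ->
  (forall d, ~~ on_strands s d.1 -> ~~ on_strands s d.2 ->
    \sum_(x \in inner_crossings s D) link D d x =
    \sum_(x \in inner_crossings s D') link D' d x) ->
  \sum_(d \in inner_crossings s D)
     T (intersection_index D d) *~ crossing_sign D d =
  \sum_(d \in inner_crossings s D')
     T (intersection_index D' d) *~ crossing_sign D' d ->
  chord_sum D T = chord_sum D' T.
Proof.
move=> so H1 H2; rewrite /chord_sum !split_crossings H2; congr (_ + _).
rewrite (outer_crossingsE so); apply: eq_fsbigr => d; rewrite inE.
rewrite -(outer_crossingsE so) => od; have [dd nd] := od.
have nd2 : ~~ on_strands s d.2 by rewrite -(on_strands_double_point so dd).
suff -> : intersection_index D d = intersection_index D' d.
  by rewrite (sign_outside so od).
rewrite !intersection_indexE !split_crossings (H1 d nd nd2).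
apply: (congr1 (+%R^~ _)); rewrite (outer_crossingsE so); apply: eq_fsbigr => x.
rewrite inE -(outer_crossingsE so) => ox.
by rewrite /link (weight_outside so ox).
Qed.

End SameOutside.

(** * Invariance under the moves *)

Section Strands.
Variable R : realType.
Implicit Types (a b d e x : R * R) (t u v : R).

(** An interval lies entirely on one side of any point outside it. *)
Lemma strand_lt a t u v : ~~ on_strand a v -> on_strand a t -> on_strand a u ->
  (v < t) = (v < u) /\ (t < v) = (u < v).
Proof.
rewrite /on_strand negb_and -!ltNge => /orP[h|h] /andP[t1 t2] /andP[u1 u2].
  rewrite (lt_le_trans h t1) (lt_le_trans h u1).
  by rewrite !ltNge (ltW (lt_le_trans h t1)) (ltW (lt_le_trans h u1)).
rewrite (le_lt_trans t2 h) (le_lt_trans u2 h).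
by rewrite !ltNge (ltW (le_lt_trans t2 h)) (ltW (le_lt_trans u2 h)).
Qed.

Lemma on_closed_same_strand a d t u :
  ~~ on_strand a d.1 -> ~~ on_strand a d.2 -> on_strand a t -> on_strand a u ->
  on_closed d t = on_closed d u.
Proof.
move=> d1 d2 ht hu; rewrite /on_closed.
by rewrite (strand_lt d1 ht hu).1 (strand_lt d2 ht hu).2.
Qed.

(** The ends of [d] and [e] on a common strand can be separated only by parameters of that
    strand. *)
Lemma on_closed_parallel a b d e t :
  ~~ on_strand a t -> ~~ on_strand b t -> between a b d -> between a b e ->
  on_closed d t = on_closed e t.
Proof.
move=> na nb /andP[d1 d2] /andP[e1 e2]; rewrite /on_closed.
by rewrite (strand_lt na d1 e1).2 (strand_lt nb d2 e2).1.
Qed.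

Lemma on_closed_kink a d t :
  on_strand a d.1 -> on_strand a d.2 -> ~~ on_strand a t ->
  on_closed d t = false.
Proof.
move=> d1 d2 nt; rewrite /on_closed (strand_lt nt d1 d2).2.
by apply/negbTE; rewrite negb_and -leNgt orbC -leNgt le_total.
Qed.

End Strands.

Section SmallSums.
Variables (V : zmodType) (I : choiceType).
Implicit Type F : I -> V.

Lemma fsbig_pair F d e : d <> e ->
  \sum_(x \in [set d; e]) F x = F d + F e.
Proof.
move=> ne; rewrite fsbigU0 ?fsbig_set1 //; try exact: finite_set1.
by move=> x [/= ->].
Qed.

Lemma fsbig_triple F c d e : c <> d -> c <> e -> d <> e ->
  \sum_(x \in [set c; d; e]) F x = F c + F d + F e.
Proof.
move=> cd ce de; rewrite fsbigU0.
- by rewrite fsbig_set1 fsbig_pair.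
- by rewrite finite_setU; split; exact: finite_set1.
- exact: finite_set1.
- by move=> x [/= [] ->].
Qed.

End SmallSums.

(** * Kinks and the second Reidemeister move *)

Section MovesOneTwo.
Variables (R : realType) (V : zmodType) (T : int -> V).
Implicit Types (D : diagram R) (a b d e x : R * R).

Lemma inner_on_strands s D D' d : same_outside s D D' -> inner_crossings s D' d ->
  [/\ double_points (curve D') d, on_strands s d.1 & on_strands s d.2].
Proof.
move=> so [dd d1]; split => //.
by rewrite -(on_strands_double_point (same_outside_sym so) dd).
Qed.

Lemma on_strands1 a t : on_strands [:: a] t = on_strand a t.
Proof. by rewrite /on_strands /= orbF. Qed.

Lemma link_kink D a d x : on_strand a x.1 -> on_strand a x.2 ->
  ~~ on_strand a d.1 -> ~~ on_strand a d.2 -> link D d x = 0.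
Proof.
move=> x1 x2 d1 d2; rewrite /link (on_closed_same_strand d1 d2 x1 x2).
by rewrite subrr mul0r.
Qed.

Lemma outer_index_kink D D' a d : same_outside [:: a] D D' ->
  on_strand a d.1 -> on_strand a d.2 ->
  \sum_(x \in outer_crossings [:: a] D') link D' d x = 0.
Proof.
move=> so d1 d2; apply: fsbig1 => x [dx nx].
have nx2 : ~~ on_strands [:: a] x.2.
  by rewrite -(on_strands_double_point (same_outside_sym so) dx).
move: nx nx2; rewrite !on_strands1 => nx nx2.
by rewrite /link !(on_closed_kink d1 d2)// subrr mul0r.
Qed.

(** The loop of the kink stays within its strand and is linked with nothing, so the kink has index
    0. Its term vanishes by [T 0 = 0] if the crossing is classical, and by its zero sign if it is
    virtual. *)
Lemma move1_chord_sum (is_classical : bool) D D' :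
  (is_classical -> T 0 = 0) -> move1 is_classical D D' ->
  chord_sum D T = chord_sum D' T.
Proof.
move=> T0 [a [d [so i0 i1 cl]]].
have [|dd] := inner_on_strands (d := d) so; first by rewrite i1.
rewrite !on_strands1 => d1 d2.
apply: (chord_sum_move so).
  move=> x; rewrite !on_strands1 i0 i1 fsbig_set0 fsbig_set1 => x1 x2.
  by rewrite (link_kink D' d1 d2 x1 x2).
rewrite i0 i1 fsbig_set0 fsbig_set1.
rewrite intersection_indexE (split_crossings [:: a]) i1 fsbig_set1.
rewrite (outer_index_kink so d1 d2) link_self addr0.
move: T0 cl; case: is_classical => [-> // _|_]; first by rewrite mul0rz.
by rewrite /crossing_sign; case: (deco D' d) => //; rewrite mulr0z.
Qed.

(** The two loops occupy disjoint intervals of the strand, so both kinks have index 0, and their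
    opposite signs cancel whatever [T 0] is. *)
Lemma framed_move1_chord_sum D D' : framed_move1 D D' ->
  chord_sum D T = chord_sum D' T.
Proof.
move=> [a [d [e [so i0 [i2 de] [cd ce] sde]]]].
have [|dd] := inner_on_strands (d := d) so; first by rewrite i2; left.
rewrite !on_strands1 => d1 d2.
have [|ee] := inner_on_strands (d := e) so; first by rewrite i2; right.
rewrite !on_strands1 => e1 e2.
have [[d12 _] [e12 _]] := (dd, ee).
have ne : d <> e.
  by move=> h; move: de; rewrite -h ltNge (ltW d12).
apply: (chord_sum_move so).
  move=> x; rewrite !on_strands1 i0 i2 fsbig_set0 fsbig_pair// => x1 x2.
  by rewrite (link_kink D' d1 d2 x1 x2) (link_kink D' e1 e2 x1 x2) addr0.
rewrite i0 i2 fsbig_set0 fsbig_pair//.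
have -> : intersection_index D' d = 0.
  rewrite intersection_indexE (split_crossings [:: a]) i2 fsbig_pair//.
  rewrite (outer_index_kink so d1 d2) link_self !add0r.
  rewrite /link /on_closed (ltNge e.1) (ltW de) (ltNge e.2).
  by rewrite (ltW (lt_trans de e12)) !andbF subrr mul0r.
have -> : intersection_index D' e = 0.
  rewrite intersection_indexE (split_crossings [:: a]) i2 fsbig_pair//.
  rewrite (outer_index_kink so e1 e2) link_self !addr0 add0r.
  rewrite /link /on_closed (ltNge e.1) (ltNge e.1) (ltW de).
  by rewrite (ltW (lt_trans d12 de)) subrr mul0r.
by rewrite sde mulrNz addNr.
Qed.

(** This serves for a crossing and its image under the third move and, with one diagram in both
    places, for the two crossings of the second move. *)
Lemma outer_index_parallel D D' s a b d e : same_outside s D D' ->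
  a \in s -> b \in s -> between a b d -> between a b e ->
  \sum_(x \in outer_crossings s D) link D d x =
  \sum_(x \in outer_crossings s D') link D' e x.
Proof.
move=> so sa sb bd be; rewrite (outer_crossingsE so).
apply: eq_fsbigr => x; rewrite inE -(outer_crossingsE so) => ox.
rewrite /link (weight_outside so ox); have [dx nx] := ox.
have nx2 : ~~ on_strands s x.2 by rewrite -(on_strands_double_point so dx).
have off c t : c \in s -> ~~ on_strands s t -> ~~ on_strand c t.
  by move=> cs; apply: contra => ct; apply/hasP; exists c.
rewrite (on_closed_parallel (off a _ sa nx) (off b _ sb nx) bd be).
by rewrite (on_closed_parallel (off a _ sa nx2) (off b _ sb nx2) bd be).
Qed.

Lemma same_outside_refl s D D' : same_outside s D D' -> same_outside s D' D'.
Proof.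
move=> [so1 [c [r [r0 H]]] _ _]; split => //.
by exists c, r; split => // t; have [] := H t.
Qed.

(** The new crossings have opposite weights and so cancel in every outer index; having equal indices
    and opposite signs, they also cancel in the sum. *)
Lemma move2_chord_sum D D' : move2 D D' -> chord_sum D T = chord_sum D' T.
Proof.
move=> [a [b [d [e [so i0 [i2 ne] [bd be] [ded wde]]]]]].
have [|dd _ _] := inner_on_strands (d := d) so; first by rewrite i2; left.
have [|ee _ _] := inner_on_strands (d := e) so; first by rewrite i2; right.
have [[d12 _] [e12 _]] := (dd, ee).
have [n11 n12 n21 n22] := double_point_neq dd ee ne.
have wE : weight D' d = - weight D' e.
  by rewrite /weight ded wde; case: ifP => //; rewrite oppr0.
have sE : crossing_sign D' d = - crossing_sign D' e.
  rewrite /crossing_sign ded; case: (deco D' e); first by rewrite oppr0.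
    exact: wde.
  by rewrite orientationC wde (orientationC _ e.1).
have /andP[d1 d2] := bd; have /andP[e1 e2] := be.
have ab : a.2 < b.1 by have [/= /and4P[]] := so.
have d1e2 : d.1 < e.2.
  by move: d1 e2; rewrite /on_strand => /andP[_ ?] /andP[? _]; lra.
have e1d2 : e.1 < d.2.
  by move: e1 d2; rewrite /on_strand => /andP[_ ?] /andP[? _]; lra.
apply: (chord_sum_move so).
  move=> x x1 x2; rewrite i0 i2 fsbig_set0 fsbig_pair//.
  move: x1 x2; rewrite /on_strands /= !orbF !negb_or.
  move=> /andP[xa1 xb1] /andP[xa2 xb2].
  rewrite /link wE (on_closed_same_strand xa1 xa2 d1 e1).
  by rewrite (on_closed_same_strand xb1 xb2 d2 e2); ring.
rewrite i0 i2 fsbig_set0 fsbig_pair//.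
suff -> : intersection_index D' d = intersection_index D' e.
  by rewrite sE mulrNz addNr.
rewrite !intersection_indexE !(split_crossings [:: a; b]) i2 !fsbig_pair//.
rewrite !link_self addr0 add0r.
have sa : a \in [:: a; b] by rewrite inE eqxx.
have sb : b \in [:: a; b] by rewrite !inE eqxx orbT.
rewrite (outer_index_parallel (same_outside_refl so) sa sb bd be).
(* Exchanging [d] and [e] reverses their order along both strands, which negates the difference in
   [link]; the opposite weights restore the sign. *)
suff -> : link D' d e = link D' e d by [].
rewrite /link wE /on_closed d1e2 e1d2 (ltNge e.1) (ltNge e.2 d.2) !le_eqVlt.
rewrite (negbTE n11) (negbTE n22).
by case: (d.1 < e.1); case: (d.2 < e.2) => /=; ring.
Qed.

End MovesOneTwo.

(** * The third Reidemeister move *)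

Section MoveThree.
Variables (R : realType) (V : zmodType) (T : int -> V).
Implicit Types (D : diagram R) (a b d e x : R * R).

Lemma strand_order a b t u :
  a.2 < b.1 -> on_strand a t -> on_strand b u -> t < u :> R.
Proof. by rewrite /on_strand => ab /andP[_ h] /andP[h' _]; lra. Qed.

(** Comparisons between parameters of different strands are settled by the order of the strands. The
    mutual links thus depend only on the weights and on [o1], [o2], [o3], the three booleans that
    the move negates. *)
Lemma triangle_links D a1 a2 a3 c12 c13 c23 :
  a1.2 < a2.1 -> a2.2 < a3.1 -> a1.2 < a3.1 ->
  between a1 a2 c12 -> between a1 a3 c13 -> between a2 a3 c23 ->
  c12.1 != c13.1 -> c12.2 != c23.1 -> c13.2 != c23.2 ->
  let o1 := c12.1 < c13.1 in
  let o2 := c12.2 < c23.1 in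
  let o3 := c13.2 < c23.2 in
  [/\ link D c12 c13 + link D c12 c23 =
        - ((o1 : nat)%:Z * weight D c13) - (~~ o2 : nat)%:Z * weight D c23,
      link D c13 c12 + link D c13 c23 =
        (o1 : nat)%:Z * weight D c12 - (o3 : nat)%:Z * weight D c23 &
      link D c23 c12 + link D c23 c13 =
        (~~ o2 : nat)%:Z * weight D c12 + (o3 : nat)%:Z * weight D c13].
Proof.
move=> l12 l23 l13 /andP[p1 p2] /andP[q1 q3] /andP[r2 r3] n1 n2 n3 /=.
have lt12 t u : on_strand a1 t -> on_strand a2 u -> (t < u) * ((u < t) = false).
  by move=> ht hu; have h := strand_order l12 ht hu; rewrite h ltNge ltW.
have lt13 t u : on_strand a1 t -> on_strand a3 u -> (t < u) * ((u < t) = false).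
  by move=> ht hu; have h := strand_order l13 ht hu; rewrite h ltNge ltW.
have lt23 t u : on_strand a2 t -> on_strand a3 u -> (t < u) * ((u < t) = false).
  by move=> ht hu; have h := strand_order l23 ht hu; rewrite h ltNge ltW.
have flip (t u : R) : t != u -> (u < t) = ~~ (t < u) :> bool.
  by move=> ne; rewrite -leNgt le_eqVlt eq_sym (negbTE ne).
rewrite /link /on_closed (flip _ _ n1) (flip _ _ n2) (flip _ _ n3).
rewrite !(lt12 _ _ p1 p2, lt12 _ _ p1 r2, lt12 _ _ q1 p2, lt12 _ _ q1 r2).
rewrite !(lt13 _ _ p1 q3, lt13 _ _ p1 r3, lt13 _ _ q1 q3, lt13 _ _ q1 r3).
rewrite !(lt23 _ _ p2 q3, lt23 _ _ p2 r3, lt23 _ _ r2 q3, lt23 _ _ r2 r3).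
move: (weight D c12) (weight D c13) (weight D c23) => w12 w13 w23.
case: (c12.1 < c13.1); case: (c12.2 < c23.1); case: (c13.2 < c23.2);
by split; rewrite /= ?mul1r ?mul0r ?subrr ?sub0r ?subr0 ?addr0 ?add0r ?mulN1r.
Qed.

Lemma index_triple D s c d e : inner_crossings s D = [set c; d; e] ->
  c <> d -> c <> e -> d <> e ->
  [/\ intersection_index D c =
        \sum_(x \in outer_crossings s D) link D c x + (link D c d + link D c e),
      intersection_index D d =
        \sum_(x \in outer_crossings s D) link D d x + (link D d c + link D d e) &
      intersection_index D e =
        \sum_(x \in outer_crossings s D) link D e x + (link D e c + link D e d)].
Proof.
move=> i3 cd ce de.
have E u : intersection_index D u = \sum_(x \in outer_crossings s D) link D u x +
    (link D u c + link D u d + link D u e).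
  rewrite intersection_indexE (split_crossings s).
  by apply: (congr1 (+%R _)); rewrite i3; exact: fsbig_triple.
by split; rewrite E link_self ?add0r ?addr0.
Qed.

Lemma same_strand_link D D' a b d x x' :
  ~~ on_strand a d.1 -> ~~ on_strand a d.2 ->
  ~~ on_strand b d.1 -> ~~ on_strand b d.2 ->
  between a b x -> between a b x' -> weight D' x' = weight D x ->
  link D d x = link D' d x'.
Proof.
move=> a1 a2 b1 b2 /andP[x1 x2] /andP[x1' x2'] w.
rewrite /link w (on_closed_same_strand a1 a2 x1 x1').
by rewrite (on_closed_same_strand b1 b2 x2 x2').
Qed.

Lemma crossing_sign_eq D D' d d' : deco D' d' = deco D d ->
  orientation D' d'.1 d'.2 = orientation D d.1 d.2 ->
  crossing_sign D' d' = crossing_sign D d.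
Proof.
move=> dd ww; rewrite /crossing_sign dd; case: (deco D d) => [//||].
  exact: ww.
by rewrite (orientationC D' d'.1) (orientationC D d.1) ww.
Qed.

Lemma move3_chord_sum D D' : move3 D D' -> chord_sum D T = chord_sum D' T.
Proof.
move=> [a1 [a2 [a3 [c12 [c13 [c23 [c12' [c13' [c23' H]]]]]]]]].
have {H} [so [iD iD'] [[b12 b13 b23] [b12' b13' b23']]
  [f1 f2 f3 [t1 t2 t3]] [md [d12 d13 d23] [w12 w13 w23]]] := H.
have [l12 l13 l23] : [/\ a1.2 < a2.1, a1.2 < a3.1 & a2.2 < a3.1].
  by have [/= /and5P[? ? ? ? /andP[? ?]] _ _ _] := so; split; lra.
have so' := same_outside_sym so.
have distinct (E : diagram R) e12 e13 e23 :
    [/\ between a1 a2 e12, between a1 a3 e13 & between a2 a3 e23] ->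
    [/\ e12 <> e13, e12 <> e23 & e13 <> e23].
  move=> [/andP[p1 p2] /andP[q1 q3] /andP[r2 r3]].
  have h1 := strand_order l23 p2 q3.
  have h2 := strand_order l12 p1 r2.
  have h3 := strand_order l12 q1 r2.
  by split=> h; [move: h1|move: h2|move: h3]; rewrite h ltxx.
have dbl (E : diagram R) e12 e13 e23 :
    inner_crossings [:: a1; a2; a3] E = [set e12; e13; e23] ->
    [/\ double_points (curve E) e12, double_points (curve E) e13 &
        double_points (curve E) e23].
  move=> iE; have H x : [set e12; e13; e23] x -> double_points (curve E) x.
    by rewrite -iE => -[].
  by split; apply: H => /=; tauto.
have [n1 n2 n3] := distinct D _ _ _ (And3 b12 b13 b23).
have [n1' n2' n3'] := distinct D' _ _ _ (And3 b12' b13' b23').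
have [e12 e13 e23] := dbl _ _ _ _ iD.
have [e12' e13' e23'] := dbl _ _ _ _ iD'.
have [W12 W13 W23] : [/\ weight D' c12' = weight D c12,
    weight D' c13' = weight D c13 & weight D' c23' = weight D c23].
  by split; [rewrite /weight d12 w12|rewrite /weight d13 w13|
    rewrite /weight d23 w23].
apply: (chord_sum_move so).
  move=> d; rewrite /on_strands /= !orbF !negb_or.
  move=> /and3P[u1 u2 u3] /and3P[v1 v2 v3].
  rewrite iD iD' (fsbig_triple _ n1 n2 n3) (fsbig_triple _ n1' n2' n3').
  rewrite (same_strand_link u1 v1 u2 v2 b12 b12' W12).
  rewrite (same_strand_link u1 v1 u3 v3 b13 b13' W13).
  by rewrite (same_strand_link u2 v2 u3 v3 b23 b23' W23).
have [I12 I13 I23] := index_triple iD n1 n2 n3.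
have [I12' I13' I23'] := index_triple iD' n1' n2' n3'.
have [m1 _ _ _] := double_point_neq e12 e13 n1.
have [_ _ m2 _] := double_point_neq e12 e23 n2.
have [_ _ _ m3] := double_point_neq e13 e23 n3.
have [m1' _ _ _] := double_point_neq e12' e13' n1'.
have [_ _ m2' _] := double_point_neq e12' e23' n2'.
have [_ _ _ m3'] := double_point_neq e13' e23' n3'.
have [L12 L13 L23] := triangle_links D l12 l23 l13 b12 b13 b23 m1 m2 m3.
have [L12' L13' L23'] :=
  triangle_links D' l12 l23 l13 b12' b13' b23' m1' m2' m3'.
have s1 : a1 \in [:: a1; a2; a3] by rewrite !inE eqxx.
have s2 : a2 \in [:: a1; a2; a3] by rewrite !inE eqxx !orbT.
have s3 : a3 \in [:: a1; a2; a3] by rewrite !inE eqxx !orbT.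
rewrite iD iD' (fsbig_triple _ n1 n2 n3) (fsbig_triple _ n1' n2' n3').
rewrite (crossing_sign_eq d12 w12) (crossing_sign_eq d13 w13).
rewrite (crossing_sign_eq d23 w23).
(* The index of a virtual crossing may change, but its sign is 0; equal indices are required of
   classical crossings only. *)
have term (c c' : R * R) : 
  (classical (deco D c) -> intersection_index D c = intersection_index D' c') ->
  T (intersection_index D c) *~ crossing_sign D c =
  T (intersection_index D' c') *~ crossing_sign D c.
  move=> H; have [/H -> //|cl] := boolP (classical (deco D c)).
  have -> : crossing_sign D c = 0.
    rewrite /crossing_sign; case: (deco D c) cl => [_|/negP/(_ isT)[]|/negP/(_ isT)[]].
    exact: erefl.
  exact: etrans (mulr0z _) (esym (mulr0z _)).
suff [J12 J13 J23] : [/\ classical (deco D c12) ->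
      intersection_index D c12 = intersection_index D' c12',
    classical (deco D c13) ->
      intersection_index D c13 = intersection_index D' c13' &
    classical (deco D c23) ->
      intersection_index D c23 = intersection_index D' c23'].
  by apply: f_equal2; [apply: f_equal2; [exact: term J12|exact: term J13]|
    exact: term J23].
have P12 := outer_index_parallel so s1 s2 b12 b12'.
have P13 := outer_index_parallel so s1 s3 b13 b13'.
have P23 := outer_index_parallel so s2 s3 b23 b23'.
have {P12 I12 L12} I12 := etrans I12 (f_equal2 +%R P12 L12).
have {P13 I13 L13} I13 := etrans I13 (f_equal2 +%R P13 L13).
have {P23 I23 L23} I23 := etrans I23 (f_equal2 +%R P23 L23).
have {I12' L12'} I12' := etrans I12' (congr1 (+%R _) L12').
have {I13' L13'} I13' := etrans I13' (congr1 (+%R _) L13').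
have {I23' L23'} I23' := etrans I23' (congr1 (+%R _) L23').
rewrite {term}I12 I13 I23 I12' I13' I23' f1 f2 f3 W12 W13 W23
  {I12 I13 I23 I12' I13' I23'}.
move: (\sum_(x \in _) link D' c12' x) (\sum_(x \in _) link D' c13' x)
  (\sum_(x \in _) link D' c23' x) => S12 S13 S23.
have O12 := orientation_double_point e12.
have O13 := orientation_double_point e13.
have O23 := orientation_double_point e23.
(* Weights see only which crossings are classical: at most one of the three, or all of them. *)
have md' : let k12 := classical (deco D c12) in
    let k13 := classical (deco D c13) in let k23 := classical (deco D c23) in
    [|| ~~ k12 && ~~ k13, ~~ k12 && ~~ k23, ~~ k13 && ~~ k23
      | [&& k12, k13 & k23]].
  by move: md; case: (deco D c12); case: (deco D c13); case: (deco D c23).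
move: md' O12 O13 O23 t1 t2 t3; rewrite /weight /=.
move: (orientation D c12.1 c12.2) (orientation D c13.1 c13.2)
  (orientation D c23.1 c23.2) => {w12 w13 w23 W12 W13 W23} w12 w13 w23.
case: (classical (deco D c12)); case: (classical (deco D c13));
case: (classical (deco D c23)) => //= _.
- (* By [triangle], the two contributions to an index that the move switches off
     and on are equal or cancel. *)
  have ne1 : (1 == - 1 :> int) = false by [].
  have ne2 : (- 1 == 1 :> int) = false by [].
  case: (c12.1 < c13.1); case: (c12.2 < c23.1); case: (c13.2 < c23.2);
  move=> [-> | ->] [-> | ->] [-> | ->]; rewrite ?eqxx ?ne1 ?ne2 => // _ _ _;
  by split => _; exact: congr1.
(* In the remaining cases a single crossing is classical, and its index receives only the zero
   weights of the two virtual ones. *)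
- by move=> *; rewrite !mulr0 !subrr; split.
- by move=> *; rewrite !mulr0 !subrr; split.
- by move=> *; rewrite !mulr0 !subrr; split.
Qed.

End MoveThree.

(** * Invariance under planar isotopy *)

Section Isotopy.
Variables (R : realType).

(** Multiplicativity of the determinant, to be applied to the differential of a plane
    diffeomorphism. *)
Lemma det2_linear (L : {linear (R * R)%type -> (R * R)%type}) (u v : R * R) :
  det2 (L u) (L v) = det2 (L (1, 0)) (L (0, 1)) * det2 u v.
Proof.
have scale_pair (k : R) (w : R * R) : k *: w = (k * w.1, k * w.2) by [].
have add_pair (w w' : R * R) : w + w' = (w.1 + w'.1, w.2 + w'.2) by [].
have E (w : R * R) : L w = w.1 *: L (1, 0) + w.2 *: L (0, 1).
  rewrite -!linearZ -linearD; congr (L _).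
  by rewrite !scale_pair add_pair /= !mulr1 !mulr0 addr0 add0r; case: w.
rewrite (E u) (E v) !scale_pair !add_pair /det2 /=.
by case: (L (1, 0)) => a b; case: (L (0, 1)) => c d /=; ring.
Qed.

Lemma det2Z (a b : R) (u v : R * R) :
  det2 (a *: u) (b *: v) = a * b * det2 u v.
Proof.
have scale_pair (k : R) (w : R * R) : k *: w = (k * w.1, k * w.2) by [].
by rewrite !scale_pair /det2 /=; ring.
Qed.

Variables (D D' : diagram R) (F : R * R -> R * R) (h : R -> R).
Hypotheses (diffeoF : plane_diffeo F) (diffeoh : line_diffeo h).
Hypothesis curveE : forall t, curve D' t = F (curve D (h t)).
Hypothesis decoE : forall d, double_points (curve D') d ->
  deco D' d = deco D (h d.1, h d.2).

Let H (d : R * R) := (h d.1, h d.2).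

Lemma line_diffeo_mono : {mono h : s t / s < t}.
Proof.
have [sh h0 _] := diffeoh.
have dh t : derivable h t 1 by exact: (sh 0%N t).
have inc s t : s < t -> h s < h t.
  move=> st.
  have cont : {within `[s, t], continuous h}.
    by apply: derivable_within_continuous => x _; exact: dh.
  have [x _ e] := MVT st (fun x _ => derivableP (dh x)) cont.
  by rewrite -subr_gt0 e -derive1E mulr_gt0 ?subr_gt0.
by apply: leW_mono; apply: le_mono.
Qed.

Lemma derive1_isotopic t : derive1 (curve D') t =
  'd F (curve D (h t)) (derive1 h t *: derive1 (curve D) (h t)).
Proof.
have [sh h0 _] := diffeoh; have [[G smooth _] _ _] := diffeoF.
have dh : differentiable h t by apply/derivable1_diffP; exact: (sh 0%N t).
have dc : differentiable (curve D) (h t).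
  by apply/derivable1_diffP; exact: (@curve_smooth R D 0%N (h t)).
have dF p : differentiable F p by have [[]] := smooth 1%N.
have -> : curve D' = F \o (curve D \o h) by apply/funext => u; rewrite curveE.
rewrite derive1E'; last first.
  by apply: differentiable_comp (dF _); exact: differentiable_comp dc.
rewrite (diff_comp (differentiable_comp dh dc) (dF _)) (diff_comp dh dc).
rewrite (derive1E' dc) (derive1E' dh) /=.
have -> // : 'd h t 1 *: 'd (curve D) (h t) 1 = 'd (curve D) (h t) ('d h t 1).
by rewrite -linearZ -[_ *: 1]/(_ * 1) mulr1.
Qed.

(** Both tangents at a double point are transformed by the same differential of [F], whose
    determinant is positive, and are rescaled by positive derivatives of [h]. *)
Lemma orientation_isotopic s t : curve D (h s) = curve D (h t) ->
  orientation D' s t = orientation D (h s) (h t).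
Proof.
have [sh h0 _] := diffeoh; have [[G smooth _] detF _] := diffeoF.
have dF p : differentiable F p by have [[]] := smooth 1%N.
move=> e; rewrite /orientation (derive1_isotopic s) (derive1_isotopic t) e.
move: (derive1 (curve D) (h s)) (derive1 (curve D) (h t)) => u v.
rewrite det2_linear -!deriveE // det2Z !sgzM (gtr0_sgz (h0 s)) (gtr0_sgz (h0 t)).
by rewrite (gtr0_sgz (detF _)) !mul1r.
Qed.

Lemma isotopic_double_pointsP d : double_points (curve D') d <->
  double_points (curve D) (H d).
Proof.
have [[G _ [FK _]] _ _] := diffeoF.
rewrite /double_points /= line_diffeo_mono !curveE.
by split=> -[-> e]; split => //; [exact: (can_inj FK)|rewrite e].
Qed.

Lemma isotopic_bij :
  set_bij (double_points (curve D')) (double_points (curve D)) H.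
Proof.
have [_ _ [k hK kK]] := diffeoh.
split.
- by move=> d /isotopic_double_pointsP.
- by move=> [a b] [c e] _ _ [/(can_inj hK) -> /(can_inj hK) ->].
- move=> d dd; exists (k d.1, k d.2); last by rewrite /H /= !kK; case: d dd.
  by apply/isotopic_double_pointsP; rewrite /H /= !kK; case: d dd.
Qed.

Lemma on_closed_isotopic d t : on_closed d t = on_closed (H d) (h t).
Proof. by rewrite /on_closed /= !line_diffeo_mono. Qed.

Lemma orientation_isotopic_double_point d : double_points (curve D') d ->
  orientation D' d.1 d.2 = orientation D (H d).1 (H d).2.
Proof.
move=> /isotopic_double_pointsP [_ e]; exact: orientation_isotopic.
Qed.

Lemma weight_isotopic d : double_points (curve D') d ->
  weight D' d = weight D (H d).
Proof.
by move=> dd; rewrite /weight (decoE dd) (orientation_isotopic_double_point dd).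
Qed.

Lemma intersection_index_isotopic d :
  intersection_index D' d = intersection_index D (H d).
Proof.
rewrite !intersection_indexE (reindex_fsbig _ _ _ _ isotopic_bij).
apply: eq_fsbigr => x; rewrite inE => dx.
by rewrite /link (weight_isotopic dx) !(on_closed_isotopic d).
Qed.

Lemma chord_sum_isotopic (V : zmodType) (T : int -> V) :
  chord_sum D T = chord_sum D' T.
Proof.
rewrite /chord_sum (reindex_fsbig _ _ _ _ isotopic_bij).
apply: eq_fsbigr => x; rewrite inE => dx.
rewrite -intersection_index_isotopic; congr (_ *~ _).
apply/esym/crossing_sign_eq; first exact: decoE.
exact: orientation_isotopic_double_point.
Qed.

End Isotopy.

Section Invariance.
Variables (R : realType) (c : category) (V : zmodType) (T : int -> V).
Hypothesis T0 : c = Unframed -> T 0 = 0.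

(** [T0] is asked for in the unframed category, where a single classical kink, of index 0, can be
    created. *)
Lemma chord_sum_equivalent (D D' : diagram R) :
  equivalent c D D' -> chord_sum D T = chord_sum D' T.
Proof.
elim => [{}D {}D'|//|E E' _ -> //|E E' E'' _ -> _ -> //].
case=> [[F [h [dF dh ce de]]]|[|[|[]]]].
- exact: chord_sum_isotopic dF dh ce de _ _.
- move: T0; rewrite /classical_move1; case: c => [/(_ erefl) t0|_].
    by apply: move1_chord_sum.
  exact: framed_move1_chord_sum.
- exact: move1_chord_sum.
- exact: move2_chord_sum.
- exact: move3_chord_sum.
Qed.

End Invariance.

(** * From the ordered polynomial to the polynomial *)

Section FoldPoly.

(* For |i| <= N, this maps 'X^(N + i) to 'X^|i|. *)
Definition fold_poly (N : nat) (p : {poly int}) : {poly int} :=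
  \sum_(j < N.*2.+1) p`_j *: 'X^(absz ((j : nat)%:Z - N%:Z)).

Lemma fold_poly_is_zmod_morphism N : zmod_morphism (fold_poly N).
Proof.
move=> p q; rewrite /fold_poly -sumrB; apply: eq_bigr => j _.
by rewrite coefB scalerBl.
Qed.
HB.instance Definition _ N :=
  GRing.isZmodMorphism.Build _ _ (fold_poly N) (fold_poly_is_zmod_morphism N).

Lemma fold_polyXn N k : (k <= N.*2)%N ->
  fold_poly N 'X^k = 'X^(absz (k%:Z - N%:Z)).
Proof.
rewrite -ltnS => kN; rewrite /fold_poly (bigD1 (Ordinal kN)) //= big1.
  by rewrite coefXn eqxx scale1r addr0.
by move=> j; rewrite -val_eqE /= => jk; rewrite coefXn (negbTE jk) scale0r.
Qed.

(** This is [t^N] times the ordered term as a genuine polynomial; [absz] changes nothing as long as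
    [|i| <= N]. *)
Definition shifted_term (c : category) (N : nat) (i : int) : {poly int} :=
  if c is Unframed then 'X^(absz (N%:Z + i)) - 'X^N else 'X^(absz (N%:Z + i)).

Lemma fold_shifted_term c N i : (`|i| <= N)%N ->
  fold_poly N (shifted_term c N i) = poly_term c i.
Proof.
move=> iN.
have E : fold_poly N 'X^(absz (N%:Z + i)) = 'X^(`|i|%N).
  rewrite fold_polyXn; last by lia.
  by congr 'X^_; lia.
rewrite /shifted_term /poly_term; case: c => //.
by rewrite raddfB /= E fold_polyXn ?subrr ?expr0 //; lia.
Qed.

Lemma laurent_t_neq0 : laurent_t != 0.
Proof. by rewrite tofrac_eq0 polyX_eq0. Qed.

Lemma tofrac_shifted_term c N i : (`|i| <= N)%N ->
  tofrac (shifted_term c N i) = laurent_t ^+ N * ordered_poly_term c i.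
Proof.
move=> iN.
have E : tofrac ('X^(absz (N%:Z + i)) : {poly int}) = laurent_t ^+ N * laurent_t ^ i.
  rewrite rmorphXn /= -/laurent_t !exprnP -expfzDr ?laurent_t_neq0 //.
  by congr (_ ^ _); lia.
rewrite /shifted_term /ordered_poly_term; case: c => //.
by rewrite rmorphB /= E rmorphXn /= mulrBr mulr1.
Qed.

End FoldPoly.

(** * The ordered polynomial determines the other one *)

Section OrderedDetermines.
Variables (R : realType) (c : category).
Implicit Type D : diagram R.

Lemma finite_classical_crossings D : finite_set (classical_crossings D).
Proof. by apply: sub_finite_set (curve_finite D) => d []. Qed.

Lemma index_bound D : exists N, forall d, classical_crossings D d ->
  (`|intersection_index D d| <= N)%N.
Proof.
exists (\max_(d <- finmap.enum_fset (fset_set (classical_crossings D)))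
  `|intersection_index D d|%N) => d dD.
apply: (@leq_bigmax_seq _ _ predT (fun d => absz (intersection_index D d))) => //.
by rewrite in_fset_set ?inE //; exact: finite_classical_crossings.
Qed.

(** A bound on all indices clears the negative powers at once; [fold_poly], being additive, then
    acts term by term. *)
Lemma shifted_diagram_poly N D :
  (forall d, classical_crossings D d -> (`|intersection_index D d| <= N)%N) ->
  exists2 Q, tofrac Q = laurent_t ^+ N * diagram_ordered_poly c D &
    diagram_poly c D = fold_poly N Q.
Proof.
move=> bound; pose A := finmap.enum_fset (fset_set (classical_crossings D)).
have AD d : d \in A -> classical_crossings D d.
  by rewrite in_fset_set ?inE //; exact: finite_classical_crossings.
exists (\sum_(d <- A) shifted_term c N (intersection_index D d) *~ crossing_sign D d).
  rewrite rmorph_sum /diagram_ordered_poly fsbig_finite /=; last first.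
    exact: finite_classical_crossings.
  rewrite mulr_sumr; apply: eq_big_seq => d /AD/bound dN.
  by rewrite rmorphMz /= mulrzAr (tofrac_shifted_term _ dN).
rewrite raddf_sum /diagram_poly fsbig_finite /=; last first.
  exact: finite_classical_crossings.
apply: eq_big_seq => d /AD/bound dN.
by rewrite raddfMz /= (fold_shifted_term _ dN).
Qed.

(** A common bound gives both diagrams the same shift; injectivity of [tofrac] then identifies the
    two polynomials to be folded. *)
Lemma ordered_poly_determines D D' :
  diagram_ordered_poly c D = diagram_ordered_poly c D' ->
  diagram_poly c D = diagram_poly c D'.
Proof.
move=> e; have [N hN] := index_bound D; have [N' hN'] := index_bound D'.
have [|Q qE ->] := @shifted_diagram_poly (maxn N N') D.
  by move=> d /hN h; rewrite leq_max h.
have [|Q' qE' ->] := @shifted_diagram_poly (maxn N N') D'.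
  by move=> d /hN' h; rewrite leq_max h orbT.
congr (fold_poly _ _); apply/eqP; rewrite -tofrac_eq.
by rewrite qE qE' e.
Qed.

(** Invariance makes the set under [xget] a singleton, so that the dummy [x0] is not returned. *)
Lemma knot_valueE (T : choiceType) (x0 : T) (f : diagram R -> T)
    (K : long_virtual_knot R c) D :
  (forall D1 D2, equivalent c D1 D2 -> f D1 = f D2) -> diagrams K D ->
  knot_value x0 f K = f D.
Proof.
move=> inv KD; have [D0 KE] := diagrams_class K.
apply: xget_subset1.
  move=> D1; move: KD; rewrite KE /= => /inv <- /inv <- //.
by move=> P Q /(_ _ KD) <- /(_ _ KD) <-.
Qed.

Lemma diagram_poly_equivalent D D' : equivalent c D D' ->
  diagram_poly c D = diagram_poly c D'.
Proof.
rewrite /diagram_poly !classical_chord_sum; apply: chord_sum_equivalent => ->.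
by rewrite /= expr0 subrr.
Qed.

Lemma diagram_ordered_poly_equivalent D D' : equivalent c D D' ->
  diagram_ordered_poly c D = diagram_ordered_poly c D'.
Proof.
rewrite /diagram_ordered_poly !classical_chord_sum.
apply: chord_sum_equivalent => ->.
by rewrite /= expr0z subrr.
Qed.

Lemma knot_polyE (K : long_virtual_knot R c) D : diagrams K D ->
  knot_poly K = diagram_poly c D.
Proof. by apply: knot_valueE => *; exact: diagram_poly_equivalent. Qed.

Lemma knot_ordered_polyE (K : long_virtual_knot R c) D : diagrams K D ->
  knot_ordered_poly K = diagram_ordered_poly c D.
Proof. by apply: knot_valueE => *; exact: diagram_ordered_poly_equivalent. Qed.

Lemma knot_ordered_poly_determines (K K' : long_virtual_knot R c) :
  knot_ordered_poly K = knot_ordered_poly K' -> knot_poly K = knot_poly K'.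
Proof.
have KD (K0 : long_virtual_knot R c) : exists D, diagrams K0 D.
  by have [D ->] := diagrams_class K0; exists D; exact: rst_refl.
have [D kD] := KD K; have [D' kD'] := KD K'.
rewrite (knot_polyE kD) (knot_polyE kD') (knot_ordered_polyE kD).
rewrite (knot_ordered_polyE kD'); exact: ordered_poly_determines.
Qed.

End OrderedDetermines.

(** * Smooth functions and cutoffs *)

Section Smooth.
Variable R : realType.

(** Quantifying over the derivative makes closure under each operation an induction on [n], with the
    usual differentiation rule as witness. *)
Fixpoint smooth_upto (V : normedModType R) (n : nat) (f : R -> V) : Prop :=
  if n is m.+1 then
    exists2 df : R -> V, forall t : R, is_derive t (1 : R) f (df t) &
      smooth_upto m df
  else True.

Definition smooth (V : normedModType R) (f : R -> V) :=
  forall n, smooth_upto n f.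

Lemma smooth_uptoW (V : normedModType R) n (f : R -> V) :
  smooth_upto n.+1 f -> smooth_upto n f.
Proof.
elim: n f => [//|n IH] f [df fdf sdf]; exists df => //; exact: IH.
Qed.

Lemma smooth_derive1 (V : normedModType R) (f : R -> V) :
  smooth f -> (forall t, derivable f t 1) /\ smooth (derive1 f).
Proof.
move=> sf; split=> [t|n]; first by have [df /(_ t) []] := sf 1%N.
have [df fdf] := sf n.+1; congr smooth_upto.
by apply/funext => t; rewrite derive1E; have [_ ->] := fdf t.
Qed.

Lemma smooth_derive1n (V : normedModType R) (f : R -> V) n t :
  smooth f -> derivable (derive1n n f) t 1.
Proof.
move=> sf; suff : smooth (derive1n n f) by move=> /smooth_derive1 [].
by elim: n => [//|n IH]; rewrite derive1nS; have [] := smooth_derive1 IH.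
Qed.

Lemma is_derive_pair (V W : normedModType R) (f : R -> V) (g : R -> W) (t : R)
    df dg :
  is_derive t (1 : R) f df -> is_derive t (1 : R) g dg ->
  is_derive t (1 : R) (fun u => (f u, g u)) (df, dg).
Proof.
move=> [/derivable1_diffP f' <-] [/derivable1_diffP g' <-].
have fg : differentiable (fun u => (f u, g u)) t by exact: differentiable_pair.
split; first exact/derivable1_diffP.
by rewrite deriveE // diff_pair // !deriveE.
Qed.

Lemma smooth_upto_pair (V W : normedModType R) n (f : R -> V) (g : R -> W) :
  smooth_upto n f -> smooth_upto n g -> smooth_upto n (fun t => (f t, g t)).
Proof.
elim: n f g => [//|n IH] f g [df fdf sdf] [dg gdg sdg].
exists (fun t => (df t, dg t)); last exact: IH.
by move=> t; exact: is_derive_pair.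
Qed.

Implicit Types f g : R -> R.

Lemma smooth_upto_cst n (c : R) : smooth_upto n (fun _ : R => c).
Proof.
elim: n c => [//|n IH] c; exists (fun=> 0) => // t; exact: is_derive_cst.
Qed.

Lemma smooth_upto_id n : smooth_upto n (fun t : R => t).
Proof.
case: n => [//|n]; exists (fun=> 1); last exact: smooth_upto_cst.
by move=> t; exact: is_derive_id.
Qed.

Lemma smooth_uptoD n f g : smooth_upto n f -> smooth_upto n g ->
  smooth_upto n (fun t => f t + g t).
Proof.
elim: n f g => [//|n IH] f g [df fdf sdf] [dg gdg sdg].
exists (fun t => df t + dg t); last exact: IH.
by move=> t; exact: is_deriveD.
Qed.

Lemma smooth_uptoM n f g : smooth_upto n f -> smooth_upto n g ->
  smooth_upto n (fun t => f t * g t).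
Proof.
elim: n f g => [//|n IH] f g sf sg.
have [df fdf sdf] := sf; have [dg gdg sdg] := sg.
exists (fun t => f t * dg t + g t * df t).
  by move=> t; exact: is_deriveM.
by apply: smooth_uptoD; apply: IH => //; exact: smooth_uptoW.
Qed.

Lemma smooth_uptoN n f : smooth_upto n f -> smooth_upto n (fun t => - f t).
Proof.
elim: n f => [//|n IH] f [df fdf sdf]; exists (fun t => - df t); last exact: IH.
by move=> t; exact: is_deriveN.
Qed.

Lemma smooth_upto_comp n f g : smooth_upto n f -> smooth_upto n g ->
  smooth_upto n (fun t => f (g t)).
Proof.
elim: n f g => [//|n IH] f g [df fdf sdf] sg; have [dg gdg sdg] := sg.
exists (fun t => df (g t) * dg t).
  by move=> t; exact: is_derive1_comp.
by apply: smooth_uptoM => //; apply: IH => //; exact: smooth_uptoW.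
Qed.

Lemma smooth_uptoV n f : (forall t, f t != 0) -> smooth_upto n f ->
  smooth_upto n (fun t => (f t)^-1).
Proof.
move=> f0; elim: n => [//|n IH] sf; have [df fdf sdf] := sf.
(* The derivative of [1/f] contains [1/f] again, but is needed to one order less. *)
have sV := IH (smooth_uptoW sf).
exists (fun t => (- 1) * ((f t)^-1 * (f t)^-1) * df t).
  move=> t; have := is_deriveV (f0 t) (fdf t).
  by move=> h; apply: is_derive_eq h _; rewrite /GRing.scale /= -exprVn; ring.
apply: smooth_uptoM => //; apply: smooth_uptoM; first exact: smooth_upto_cst.
exact: smooth_uptoM.
Qed.

(** The functions [t^-k exp(-1/t)], extended by 0 to [t <= 0]. The index [k] is there because the
    derivative of one of them is a linear combination of two others. *)
Definition flat k (t : R) : R :=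
  if 0 < t then t^-1 ^+ k * expR (- t^-1) else 0.

Lemma flat_ge0 k t : 0 <= flat k t.
Proof.
rewrite /flat; case: ifP => // t0.
by rewrite mulr_ge0 ?expR_ge0 // exprn_ge0 // invr_ge0 ltW.
Qed.

Lemma flat_le0 k t : t <= 0 -> flat k t = 0.
Proof. by move=> t0; rewrite /flat ltNge t0. Qed.

Lemma flat_gt0 k t : 0 < t -> 0 < flat k t.
Proof.
by move=> t0; rewrite /flat t0 mulr_gt0 ?expR_gt0 // exprn_gt0 // invr_gt0.
Qed.

Lemma flatS k t : flat k t = flat k.+1 t * t.
Proof.
rewrite /flat; case: ifP => t0; last by rewrite mul0r.
by rewrite exprS [RHS]mulrC !mulrA divff ?mul1r // gt_eqF.
Qed.

(** The inequality [exp x >= 1 + x^(k+1) / (k+1)!] at [x = 1/t] bounds [flat k.+1] by [(k+1)!]. The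
    estimate gives continuity at 0. *)
Lemma flat_le k t : flat k t <= k.+1`!%:R * `|t|.
Proof.
have [t0|t0] := ltP 0 t; last by rewrite flat_le0 // mulr_ge0.
rewrite gtr0_norm // flatS ler_wpM2r ?(ltW t0) //.
rewrite /flat t0 /= expRN ler_pdivrMr ?expR_gt0 //.
rewrite mulrC -ler_pdivrMr ?ltr0n ?fact_gt0 //.
have := @expR_ge1Dxn R t^-1 k; rewrite invr_ge0 (ltW t0) => /(_ isT).
by apply: le_trans; rewrite lerDr.
Qed.

Lemma is_derive_flat k (t : R) :
  is_derive t (1 : R) (flat k) (flat k.+2 t + (- k%:R) * flat k.+1 t).
Proof.
have [t0|t0|->] := ltgtP t 0.
- rewrite !flat_le0 ?ltW // mulr0 addr0.
  have d0 : is_derive t (1 : R) (fun _ : R => 0 : R) 0 by exact: is_derive_cst.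
  apply: near_eq_is_derive d0.
  near=> u; rewrite flat_le0 //; apply: ltW; near: u; exact: lt_nbhsl.
- have dV : is_derive t (1 : R) (fun u : R => u^-1) (- (t^-1 * t^-1)).
    have t1 : t != 0 by rewrite gt_eqF.
    have := is_deriveV t1 (is_derive_id t (1 : R)).
    by move=> h; apply: is_derive_eq h _; rewrite /GRing.scale /= mulr1 -exprVn expr2.
  have dE : is_derive t (1 : R) (fun u : R => expR (- u^-1)) (expR (- t^-1) * (t^-1 * t^-1)).
    have h : is_derive t (1 : R) (fun u : R => - u^-1) (t^-1 * t^-1).
      by apply: is_derive_eq (is_deriveN dV) _; rewrite opprK.
    exact: is_derive1_comp.
  have e : \forall u \near t, ((fun u : R => u^-1) ^+ k * (fun u => expR (- u^-1))) u
      = flat k u.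
    by near=> u; rewrite /flat ifT ?fctE //; near: u; exact: lt_nbhsr.
  apply: near_eq_is_derive e _.
  apply: is_derive_eq (is_deriveM (is_deriveX k dV) dE) _.
  rewrite /flat t0 /GRing.scale /= ?fctE.
  by case: k => [|k] /=; rewrite ?exprS; ring.
rewrite !flat_le0 // mulr0 addr0.
(* By [flatS], the difference quotient of [flat k] at 0 is [flat k.+1], so only the continuity of
   the latter at 0 remains. *)
apply/is_derive1_caratheodory; exists (flat k.+1); split => //.
- by move=> z; rewrite (flat_le0 _ (lexx 0)) !subr0 flatS.
- apply/cvgrPdist_lt => e e0; rewrite flat_le0 //.
  have d0 : 0 < e / k.+2`!%:R by rewrite divr_gt0 ?ltr0n ?fact_gt0.
  near=> z; rewrite sub0r normrN ger0_norm ?flat_ge0 //.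
  apply: le_lt_trans (flat_le _ _) _.
  rewrite mulrC -ltr_pdivlMr ?ltr0n ?fact_gt0 //.
by rewrite flat_le0.
Unshelve. all: by end_near. Qed.

Lemma smooth_flat k : smooth (flat k).
Proof.
move=> n; elim: n k => [//|n IH] k.
exists (fun t => flat k.+2 t + (- k%:R) * flat k.+1 t).
  exact: is_derive_flat.
by apply: smooth_uptoD => //; apply: smooth_uptoM => //; exact: smooth_upto_cst.
Qed.

(** The argument will be [t ^+ 2], so the transition from 1 to 0 takes place for
    [9 <= |t| <= 10]. *)
Definition cutoff (u : R) : R :=
  flat 0 (100 - u) / (flat 0 (100 - u) + flat 0 (u - 81)).

Lemma cutoff_den_gt0 u : 0 < flat 0 (100 - u) + flat 0 (u - 81).
Proof.
have [h|h] := ltP u 100.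
  by rewrite ltr_pwDl ?flat_ge0 // flat_gt0 // subr_gt0.
by rewrite ltr_wpDl ?flat_ge0 // flat_gt0 //; lra.
Qed.

Lemma smooth_cutoff : smooth cutoff.
Proof.
move=> n.
have s1 : smooth_upto n (fun u : R => flat 0 (100 - u)).
  apply: (smooth_upto_comp (smooth_flat 0 n)).
  apply: smooth_uptoD; first exact: smooth_upto_cst.
  by apply: smooth_uptoN; exact: smooth_upto_id.
have s2 : smooth_upto n (fun u : R => flat 0 (u - 81)).
  apply: (smooth_upto_comp (smooth_flat 0 n)).
  by apply: smooth_uptoD; [exact: smooth_upto_id|exact: smooth_upto_cst].
apply: smooth_uptoM => //; apply: smooth_uptoV; last exact: smooth_uptoD.
by move=> t; rewrite gt_eqF // cutoff_den_gt0.
Qed.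

Lemma cutoff1 u : u <= 81 -> cutoff u = 1.
Proof.
move=> h; have := cutoff_den_gt0 u.
rewrite /cutoff (flat_le0 0 (t := u - 81)) ?subr_le0 // addr0 => /gt_eqF e.
by rewrite divff // e.
Qed.

Lemma cutoff0 u : 100 <= u -> cutoff u = 0.
Proof. by move=> h; rewrite /cutoff flat_le0 ?mul0r // subr_le0. Qed.

Lemma cutoff_ge0 u : 0 <= cutoff u.
Proof. by rewrite divr_ge0 ?flat_ge0 // ltW // cutoff_den_gt0. Qed.

Lemma cutoff_le1 u : cutoff u <= 1.
Proof. by rewrite ler_pdivrMr ?cutoff_den_gt0 // mul1r lerDl flat_ge0. Qed.

Lemma is_derive_cutoff u : exists d : R,
  [/\ is_derive u (1 : R) cutoff d, d <= 0 & 100 <= u -> d = 0].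
Proof.
have d1 : is_derive u (1 : R) (fun v : R => 100 - v) (- 1).
  have := is_deriveB (is_derive_cst (100 : R) u (1 : R)) (is_derive_id u (1 : R)).
  by rewrite sub0r.
have d2 : is_derive u (1 : R) (fun v : R => v - 81) 1.
  have := is_deriveB (is_derive_id u (1 : R)) (is_derive_cst (81 : R) u (1 : R)).
  by rewrite subr0.
have a' := @is_derive1_comp R (flat 0) (fun v => 100 - v) u _ _
  (is_derive_flat 0 (100 - u)) d1.
have c' := @is_derive1_comp R (flat 0) (fun v => v - 81) u _ _
  (is_derive_flat 0 (u - 81)) d2.
have b0 : flat 0 (100 - u) + flat 0 (u - 81) != 0 by rewrite gt_eqF ?cutoff_den_gt0.
pose b v := flat 0 (100 - v) + flat 0 (v - 81).
have b' := @is_deriveV R b u _ _ b0 (is_deriveD a' c').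
have := is_deriveM a' b'.
rewrite /GRing.scale /= !oppr0 !mul0r !addr0 mulr1 mulrN1 => h.
pose a := flat 0 (100 - u); pose c := flat 0 (u - 81).
pose a1 := flat 2 (100 - u); pose c1 := flat 2 (u - 81).
exists (- (a * c1 + a1 * c) / (a + c) ^+ 2); split.
- apply: is_derive_eq h _; rewrite /b /= -/a -/c -/a1 -/c1; field; exact: b0.
- rewrite mulNr oppr_le0 divr_ge0 ?sqr_ge0 //.
  by rewrite addr_ge0 // mulr_ge0 ?flat_ge0.
- move=> u100; rewrite /a /a1 !flat_le0 ?subr_le0 //.
  by rewrite !mul0r addr0 oppr0 mul0r.
Qed.

End Smooth.

(** * A long trefoil *)

Section TrefoilCurve.
Variable R : realType.
Implicit Types s t u v : R.

(* For |t| <= 9 the curve is ((t^3 - 49 t) / 51, t^4 - 73 t^2), whose coefficients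
   are chosen so that the parameters of the three double points are integers.
   For |t| >= 9 the abscissa is increasing, which excludes other double points,
   and for |t| >= 10 the curve is the x-axis. *)
Definition pull u : R := cutoff u * ((100 - u) / 51).

Definition trefoil_x t : R := t * (1 - pull (t ^+ 2)).

Definition trefoil_y t : R := cutoff (t ^+ 2) * (t ^+ 4 - 73 * t ^+ 2).

Lemma is_derive_pull u : exists2 d : R, is_derive u (1 : R) pull d & d <= 0.
Proof.
have [d [dc d0 d100]] := is_derive_cutoff u.
have dl : is_derive u (1 : R) (fun v : R => (100 - v) / 51) (- 51^-1).
  have := is_deriveM (is_deriveB (is_derive_cst (100 : R) u (1 : R))
    (is_derive_id u (1 : R))) (is_derive_cst (51^-1 : R) u (1 : R)).
  by rewrite scaler0 add0r sub0r /GRing.scale /= mulrN1.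
have h := is_deriveM dc dl; eexists; first exact: h.
(* Beyond 100 the factor [(100 - u) / 51] is no longer positive, and it is the vanishing of [d] that
   settles the sign. *)
rewrite /GRing.scale /=; have [u100|u100] := leP 100 u.
  by rewrite d100 // mulr0 addr0 mulrN oppr_le0 mulr_ge0 ?cutoff_ge0.
have c0 := cutoff_ge0 u; have : 0 <= (100 - u) / 51 by lra.
by nra.
Qed.

Lemma pull_nincr u v : u <= v -> pull v <= pull u.
Proof.
have dp w : derivable pull w 1 by have [d []] := is_derive_pull w.
have cont a b : {within `[a, b], continuous pull}.
  by apply: derivable_within_continuous => x _; exact: dp.
rewrite le_eqVlt => /predU1P[-> //|uv].
have [x _ e] := MVT uv (fun x _ => derivableP (dp x)) (cont u v).
have [d [_ dE] d0] := is_derive_pull x; rewrite -subr_le0 e dE.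
by rewrite mulr_le0_ge0 ?subr_ge0 // ltW.
Qed.

Lemma pull_lt1 u : 81 <= u -> pull u < 1.
Proof.
move=> u81; have c0 := cutoff_ge0 u; have c1 := cutoff_le1 u.
rewrite /pull; have [u100|u100] := leP 100 u; first by rewrite cutoff0 ?mul0r.
have : 0 <= (100 - u) / 51 < 1 by apply/andP; split; lra.
by move=> /andP[]; nra.
Qed.

Lemma trefoil_inner t : t ^+ 2 <= 81 ->
  trefoil_x t = (t ^+ 3 - 49 * t) / 51 /\ trefoil_y t = t ^+ 4 - 73 * t ^+ 2.
Proof.
move=> t81; rewrite /trefoil_x /trefoil_y /pull cutoff1 // !mul1r.
by split => //; field.
Qed.

Lemma trefoil_outer t : 100 <= t ^+ 2 -> trefoil_x t = t /\ trefoil_y t = 0.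
Proof.
move=> t100; rewrite /trefoil_x /trefoil_y /pull cutoff0 // !mul0r.
by split => //; ring.
Qed.

Lemma trefoil_xN t : trefoil_x (- t) = - trefoil_x t.
Proof. by rewrite /trefoil_x sqrrN mulNr. Qed.

(** The factor [1 - pull (t ^+ 2)] is positive and nondecreasing from 9 on, while the factor [t] is
    positive and increasing. *)
Lemma trefoil_x_incr s t : 9 <= s -> s < t -> trefoil_x s < trefoil_x t.
Proof.
move=> s9 st.
have s81 : 81 <= s ^+ 2 by nra.
have p1 := pull_lt1 s81.
have p2 : pull (t ^+ 2) <= pull (s ^+ 2) by apply: pull_nincr; nra.
by rewrite /trefoil_x; nra.
Qed.

Lemma trefoil_x_le t : - 9 <= t -> t <= 9 -> - (288 / 51) <= trefoil_x t <= 288 / 51.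
Proof.
move=> t1 t2; have t81 : t ^+ 2 <= 81 by nra.
have [-> _] := trefoil_inner t81.
(* The bound is the value at 9: [288 - (t^3 - 49 t)] factors as [(9 - t) (t^2 + 9 t + 32)], and the
   quadratic factor is written as a completed square. *)
have h1 : 0 <= (9 - t) * ((t + 9 / 2) ^+ 2 + 47 / 4).
  apply: mulr_ge0; first lra.
  by rewrite addr_ge0 ?sqr_ge0 //; lra.
have h2 : 0 <= (9 + t) * ((t - 9 / 2) ^+ 2 + 47 / 4).
  apply: mulr_ge0; first lra.
  by rewrite addr_ge0 ?sqr_ge0 //; lra.
by apply/andP; split; lra.
Qed.

Lemma trefoil_x_gt t : 9 < t -> 288 / 51 < trefoil_x t.
Proof.
move=> t9; have := trefoil_x_incr (lexx 9) t9.
have [|-> _] := @trefoil_inner 9; first by lra.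
by apply: le_lt_trans; lra.
Qed.

Lemma trefoil_x_lt t : t < - 9 -> trefoil_x t < - (288 / 51).
Proof.
move=> t9; rewrite -(opprK t) trefoil_xN ltrN2; apply: trefoil_x_gt; lra.
Qed.

(** Outside [[-9, 9]] the abscissa is injective and avoids the values it takes on that interval. *)
Lemma trefoil_double_inner s t : s < t -> trefoil_x s = trefoil_x t ->
  - 9 <= s /\ t <= 9.
Proof.
move=> st e; split.
  rewrite leNgt; apply/negP => s9; have xs := trefoil_x_lt s9.
  have [t9|t9] := ltP t (- 9).
    have := @trefoil_x_incr (- t) (- s); rewrite !trefoil_xN e ltxx.
    by move=> h; have : false by apply: h; lra.
  have [t9'|t9'] := leP t 9.
    by have /andP[] := trefoil_x_le t9 t9'; lra.
  by have := trefoil_x_gt t9'; lra.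
rewrite leNgt; apply/negP => t9; have xt := trefoil_x_gt t9.
have [s9|s9] := ltP 9 s.
  by have := trefoil_x_incr (ltW s9) st; rewrite e ltxx.
have [s9'|s9'] := leP (- 9) s.
  by have /andP[] := trefoil_x_le s9' s9; lra.
by have := trefoil_x_lt s9'; lra.
Qed.

Lemma trefoil_double s t : s < t -> trefoil_x s = trefoil_x t ->
  trefoil_y s = trefoil_y t ->
  [\/ s = - 8 /\ t = 3, s = - 7 /\ t = 7 | s = - 3 /\ t = 8].
Proof.
move=> st ex ey; have [s9 t9] := trefoil_double_inner st ex.
have s81 : s ^+ 2 <= 81 by nra.
have t81 : t ^+ 2 <= 81 by nra.
have [sx sy] := trefoil_inner s81; have [tx ty] := trefoil_inner t81.
move: ex ey; rewrite sx sy tx ty {sx sy tx ty} => ex ey.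
have ts0 : t - s != 0 by rewrite subr_eq0 gt_eqF.
(* Both coordinate equations are divided by [t - s], which leaves two symmetric equations in [s] and
   [t]. *)
have e1 : t ^+ 2 + t * s + s ^+ 2 - 49 = 0.
  by apply: (mulfI ts0); rewrite mulr0; nra.
have /eqP : (t + s) * (t ^+ 2 + s ^+ 2 - 73) = 0.
  by apply: (mulfI ts0); rewrite mulr0; nra.
rewrite mulf_eq0 => /orP[/eqP ts|/eqP e2].
  apply: Or32; have sE : s = - t by lra.
  have : (t - 7) * (t + 7) = 0 by move: e1; rewrite sE; nra.
  by move=> /eqP; rewrite mulf_eq0 => /orP[] /eqP h; split; lra.
(* Here [e1] and [e2] give [t s = -24], hence [(t - s)^2 = 121] and [(t + s)^2 = 25]. *)
have d11 : (t - s - 11) * (t - s + 11) = 0 by nra.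
have s5 : (t + s - 5) * (t + s + 5) = 0 by nra.
have {}d11 : t - s = 11.
  by move/eqP: d11; rewrite mulf_eq0 => /orP[] /eqP h; lra.
move/eqP: s5; rewrite mulf_eq0 => /orP[] /eqP h.
  by apply: Or33; split; lra.
by apply: Or31; split; lra.
Qed.

End TrefoilCurve.

(** * The trefoil curve as a diagram *)

Section TrefoilDiagram.
Variable R : realType.
Implicit Types (s t : R) (k : decoration).

Definition trefoil_curve t : R * R := (trefoil_x t, trefoil_y t).

Lemma smooth_trefoil_x : smooth (@trefoil_x R).
Proof.
move=> n; have sid := smooth_upto_id R n.
have sq : smooth_upto n (fun t : R => t ^+ 2) by exact: smooth_uptoM.
have cst c := smooth_upto_cst n (c : R).
apply: smooth_uptoM => //; apply: smooth_uptoD => //; apply: smooth_uptoN.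
apply: (@smooth_upto_comp R n (@pull R) (fun t => t ^+ 2)) => //.
apply: smooth_uptoM; first exact: smooth_cutoff.
by apply: smooth_uptoM => //; apply: smooth_uptoD => //; exact: smooth_uptoN.
Qed.

Lemma smooth_trefoil_y : smooth (@trefoil_y R).
Proof.
move=> n; have sid := smooth_upto_id R n.
have sq : smooth_upto n (fun t : R => t ^+ 2) by exact: smooth_uptoM.
apply: smooth_uptoM.
  apply: (@smooth_upto_comp R n (@cutoff R) (fun t => t ^+ 2)) => //.
  exact: smooth_cutoff.
rewrite (_ : (fun t : R => _) = (fun t => t ^+ 2 * t ^+ 2 + (- 73) * t ^+ 2)).
  apply: smooth_uptoD; apply: smooth_uptoM => //; exact: smooth_upto_cst.
by apply/funext => t; ring.
Qed.

Lemma trefoil_curve_smooth : smooth_curve trefoil_curve.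
Proof.
move=> n t; apply: smooth_derive1n => m; apply: smooth_upto_pair.
  exact: smooth_trefoil_x.
exact: smooth_trefoil_y.
Qed.

Lemma derive1_trefoil_curve t dx dy : is_derive t (1 : R) (@trefoil_x R) dx ->
  is_derive t (1 : R) (@trefoil_y R) dy -> derive1 trefoil_curve t = (dx, dy).
Proof.
by move=> hx hy; rewrite derive1E; have [_ ->] := is_derive_pair hx hy.
Qed.

Lemma near_inner t : t ^+ 2 < 81 -> \forall u \near t, u ^+ 2 < 81.
Proof.
move=> t81; apply: (@cvgr_lt _ _ (nbhs t) _ (fun u : R => u ^+ 2) (t ^+ 2)) => //.
exact: exprn_continuous.
Qed.

Lemma derive1_trefoil_inner t : t ^+ 2 < 81 ->
  derive1 trefoil_curve t = ((3 * t ^+ 2 - 49) / 51, 4 * t ^+ 3 - 146 * t).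
Proof.
move=> t81.
have did := is_derive_id t (1 : R); have dc c := is_derive_cst (c : R) t (1 : R).
apply: derive1_trefoil_curve.
  have h : is_derive t (1 : R) (fun u : R => (u ^+ 3 - 49 * u) / 51)
      ((3 * t ^+ 2 - 49) / 51).
    have := is_deriveM (is_deriveB (is_deriveX 3 did) (is_deriveM (dc 49) did))
      (dc 51^-1).
    rewrite /GRing.scale /= => h; apply: is_derive_eq h _; rewrite ?fctE; ring.
  apply: near_eq_is_derive h; near=> u.
  by rewrite (trefoil_inner _).1 // ltW //; near: u; exact: near_inner.
have h : is_derive t (1 : R) (fun u : R => u ^+ 4 - 73 * u ^+ 2)
    (4 * t ^+ 3 - 146 * t).
  have := is_deriveB (is_deriveX 4 did) (is_deriveM (dc 73) (is_deriveX 2 did)).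
  rewrite /GRing.scale /= => h; apply: is_derive_eq h _; rewrite ?fctE; ring.
apply: near_eq_is_derive h; near=> u.
by rewrite (trefoil_inner _).2 // ltW //; near: u; exact: near_inner.
Unshelve. all: by end_near. Qed.

(** The derivative is [1 - pull (t^2) - 2 t^2 pull' (t^2)], where [pull (t^2) < 1] and
    [pull' <= 0]. *)
Lemma trefoil_x_derive_gt0 t : 81 <= t ^+ 2 ->
  exists2 d : R, is_derive t (1 : R) (@trefoil_x R) d & 0 < d.
Proof.
move=> t81; have [d dp d0] := is_derive_pull (t ^+ 2).
have did := is_derive_id t (1 : R).
have dsq : is_derive t (1 : R) (fun u : R => u ^+ 2) (2 * t).
  by apply: is_derive_eq (is_deriveX 2 did) _; rewrite /GRing.scale /= mulr1.
have dpq := @is_derive1_comp R (@pull R) (fun u => u ^+ 2) t _ _ dp dsq.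
have h := is_deriveM did (is_deriveB (is_derive_cst (1 : R) t (1 : R)) dpq).
eexists; first exact: h.
rewrite /GRing.scale /= ?fctE /=; have p1 := pull_lt1 t81.
have : d * t ^+ 2 <= 0 by rewrite mulr_le0_ge0 ?sqr_ge0.
by lra.
Qed.

(** For [|t| < 9] the first component vanishes only if [t^2 = 49/3], the second only if [t = 0] or
    [t^2 = 73/2]. Elsewhere the first component is positive. *)
Lemma trefoil_curve_immersion t : derive1 trefoil_curve t != (0, 0).
Proof.
have [t81|t81] := ltP (t ^+ 2) 81.
  rewrite (derive1_trefoil_inner t81) xpair_eqE; apply/negP => /andP[/eqP hx /eqP hy].
  have t2 : t ^+ 2 = 49 / 3 by lra.
  have : t * (4 * t ^+ 2 - 146) = 0 by rewrite -hy; ring.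
  rewrite t2 => /eqP; rewrite mulf_eq0 => /orP[/eqP t0|/eqP]; last by lra.
  by move: t2; rewrite t0 expr0n /=; lra.
have [d dx d0] := trefoil_x_derive_gt0 t81.
have [dy hy _] := smooth_trefoil_y 1%N.
rewrite (derive1_trefoil_curve dx (hy t)) xpair_eqE gt_eqF //.
Qed.

Lemma trefoil_curve_long :
  exists r : R, forall t, r < `|t| -> trefoil_curve t = (t, 0).
Proof.
exists 10 => t t10; rewrite /trefoil_curve.
have [|-> -> //] := @trefoil_outer R t.
by rewrite -real_normK ?num_real //; nra.
Qed.

Lemma trefoil_pointE s : - 9 <= s -> s <= 9 ->
  trefoil_curve s = ((s ^+ 3 - 49 * s) / 51, s ^+ 4 - 73 * s ^+ 2).
Proof.
move=> s1 s2; rewrite /trefoil_curve.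
by have [|-> ->] := @trefoil_inner R s; first by nra.
Qed.

Lemma trefoil_double_points : double_points trefoil_curve =
  [set (- 8, 3); (- 7, 7); (- 3, 8)].
Proof.
apply/seteqP; split => [[s t] [/= st] [ex ey]|d].
  by have [[-> ->]|[-> ->]|[-> ->]] := trefoil_double st ex ey; tauto.
by move=> [[]|] ->; (split=> /=;
  [lra|rewrite !trefoil_pointE; [congr pair; field|lra|lra|lra|lra]]).
Qed.

Lemma trefoil_finite : finite_set (double_points trefoil_curve).
Proof.
rewrite trefoil_double_points !finite_setU; do ?split; exact: finite_set1.
Qed.

Lemma trefoil_transverse d : double_points trefoil_curve d ->
  det2 (derive1 trefoil_curve d.1) (derive1 trefoil_curve d.2) != 0.
Proof.
rewrite trefoil_double_points => -[[]|] -> /=;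
by (rewrite !derive1_trefoil_inner;
  [rewrite /det2 /=; apply/eqP => h; lra|lra|lra]).
Qed.

Lemma trefoil_no_triple d e : double_points trefoil_curve d ->
  double_points trefoil_curve e -> trefoil_curve d.1 = trefoil_curve e.1 -> d = e.
Proof.
rewrite trefoil_double_points => -[[]|] -> [[]|] -> //=;
by (rewrite !trefoil_pointE; [move=> [h _]; exfalso; lra|lra|lra|lra|lra]).
Qed.

Definition trefoil_deco k1 k2 (d : R * R) : decoration :=
  if d == (- 8, 3) then k1 else if d == (- 3, 8) then k2 else Virtual.

Definition trefoil k1 k2 : diagram R :=
  Diagram (trefoil_deco k1 k2) trefoil_curve_smooth trefoil_curve_immersion
    trefoil_curve_long trefoil_finite trefoil_transverse trefoil_no_triple.

End TrefoilDiagram.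

(** * The polynomials of the two trefoil diagrams *)

Section TrefoilPolynomials.
Variable R : realType.
Let C : R * R := (- 8, 3).
Let A : R * R := (- 7, 7).
Let B : R * R := (- 3, 8).

Lemma trefoil_distinct : [/\ C <> A, C <> B & A <> B].
Proof. by split=> -[] => [h _|h _|h _]; lra. Qed.

Lemma trefoil_decoE k1 k2 :
  [/\ deco (trefoil R k1 k2) C = k1, deco (trefoil R k1 k2) A = Virtual &
      deco (trefoil R k1 k2) B = k2].
Proof.
have [CA CB AB] := trefoil_distinct.
rewrite /= /trefoil_deco -/C -/B eqxx (negbTE (introN eqP (nesym CA))).
by rewrite (negbTE (introN eqP AB)) (negbTE (introN eqP (nesym CB))) eqxx.
Qed.

Lemma orientation_trefoil k1 k2 (s t : R) : s ^+ 2 < 81 -> t ^+ 2 < 81 ->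
  (3 * s ^+ 2 - 49) / 51 * (4 * t ^+ 3 - 146 * t) <
    (4 * s ^+ 3 - 146 * s) * ((3 * t ^+ 2 - 49) / 51) ->
  orientation (trefoil R k1 k2) s t = - 1.
Proof.
move=> s81 t81 h; rewrite /orientation.
rewrite (derive1_trefoil_inner s81) (derive1_trefoil_inner t81) /det2 /=.
by rewrite ltr0_sgz // subr_lt0.
Qed.

Lemma trefoil_orientationE k1 k2 :
  orientation (trefoil R k1 k2) C.1 C.2 = - 1 /\
  orientation (trefoil R k1 k2) B.1 B.2 = - 1.
Proof. by split; apply: orientation_trefoil => /=; lra. Qed.

Lemma trefoil_virtual_chord_sum (V : zmodType) (T : int -> V) :
  chord_sum (trefoil R Virtual Virtual) T = 0.
Proof.
apply: fsbig1 => d _; suff -> : crossing_sign (trefoil R Virtual Virtual) d = 0.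
  exact: mulr0z.
by rewrite /crossing_sign /= /trefoil_deco; case: eqP => // _; case: eqP.
Qed.

(** [B] and [C] both have weight -1 and interlace, so each index is a single link. [B] starts inside
    the loop of [C], whereas [C] ends inside the loop of [B], whence the opposite indices; the
    opposite choices of overpass make the signs opposite. *)
Lemma trefoil_classical_chord_sum (V : zmodType) (T : int -> V) :
  chord_sum (trefoil R FirstOver SecondOver) T = T (- 1) - T 1.
Proof.
set D := trefoil R FirstOver SecondOver.
have [CA CB AB] := trefoil_distinct.
have [dC dA dB] : [/\ deco D C = FirstOver, deco D A = Virtual &
  deco D B = SecondOver] by exact: trefoil_decoE.
have [oC oB] : orientation D C.1 C.2 = - 1 /\ orientation D B.1 B.2 = - 1.
  exact: trefoil_orientationE.
have wC : weight D C = - 1 by rewrite /weight dC; exact: oC.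
have wA : weight D A = 0 by rewrite /weight dA.
have wB : weight D B = - 1 by rewrite /weight dB; exact: oB.
have sC : crossing_sign D C = - 1 by rewrite /crossing_sign dC; exact: oC.
have sA : crossing_sign D A = 0 by rewrite /crossing_sign dA.
have sB : crossing_sign D B = 1.
  by rewrite /crossing_sign dB orientationC oB opprK.
have DP : double_points (curve D) = [set C; A; B] by exact: trefoil_double_points.
have sumE (W : zmodType) (F : R * R -> W) :
    \sum_(d \in double_points (curve D)) F d = F C + F A + F B.
  by rewrite DP; exact: fsbig_triple.
have iC : intersection_index D C = 1.
  rewrite intersection_indexE sumE link_self /link wA wB /on_closed.
  have -> : C.1 < B.1 < C.2 by rewrite /=; lra.
  have -> : (C.1 < B.2 < C.2) = false by apply/negP; rewrite /=; lra.
  by rewrite mulr0.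
have iB : intersection_index D B = - 1.
  rewrite intersection_indexE sumE link_self /link wA wC /on_closed.
  have -> : B.1 < C.2 < B.2 by rewrite /=; lra.
  have -> : (B.1 < C.1 < B.2) = false by apply/negP; rewrite /=; lra.
  by rewrite mulr0.
rewrite /chord_sum sumE sC sA sB iC iB mulr0z addr0 mulrNz !mulr1z.
by rewrite addrC.
Qed.

End TrefoilPolynomials.

Theorem proposition10 (R : realType) (c : category) :
  (forall K K' : long_virtual_knot R c,
     knot_ordered_poly K = knot_ordered_poly K' -> knot_poly K = knot_poly K') /\
  (exists K1 K2 : long_virtual_knot R c,
     knot_poly K1 = knot_poly K2 /\
     knot_ordered_poly K1 <> knot_ordered_poly K2).
Proof.
split; first exact: knot_ordered_poly_determines.
pose knot D : long_virtual_knot R c :=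
  LongVirtualKnot (ex_intro _ D (erefl [set D' | equivalent c D D'])).
have self D : diagrams (knot D) D by exact: rst_refl.
pose D1 := trefoil R FirstOver SecondOver; pose D2 := trefoil R Virtual Virtual.
exists (knot D1), (knot D2).
have p1 : knot_poly (knot D1) = poly_term c (- 1) - poly_term c 1.
  apply: etrans (knot_polyE (self D1)) _.
  exact: etrans (classical_chord_sum _ _) (trefoil_classical_chord_sum _ _).
have p2 : knot_poly (knot D2) = 0.
  apply: etrans (knot_polyE (self D2)) _.
  exact: etrans (classical_chord_sum _ _) (trefoil_virtual_chord_sum _ _).
have q1 : knot_ordered_poly (knot D1) =
    ordered_poly_term c (- 1) - ordered_poly_term c 1.
  apply: etrans (knot_ordered_polyE (self D1)) _.
  exact: etrans (classical_chord_sum _ _) (trefoil_classical_chord_sum _ _).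
have q2 : knot_ordered_poly (knot D2) = 0.
  apply: etrans (knot_ordered_polyE (self D2)) _.
  exact: etrans (classical_chord_sum _ _) (trefoil_virtual_chord_sum _ _).
(* The terms of indices -1 and 1 coincide in the unordered polynomial, which sees absolute values
   only. *)
split; first by apply: etrans p1 (etrans _ (esym p2)); case: (c); exact: subrr.
move=> e; have /eqP := etrans (esym q1) (etrans e q2).
rewrite subr_eq0 => /eqP {}e.
have {e} : laurent_t ^ (- 1) = laurent_t ^ 1.
  by move: e; rewrite /ordered_poly_term; case: (c) => // /addIr.
(* Multiplying [t^-1 = t] by [t] gives [1 = t^2] between polynomials, which their sizes refute. *)
move=> /(congr1 ( *%R laurent_t)).
rewrite exprN1 divff ?laurent_t_neq0 // expr1z => /eqP.
rewrite -tofrac1 -tofracM tofrac_eq => /eqP /(congr1 (fun p : {poly int} => size p)).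
by rewrite size_poly1 -expr2 size_polyXn.
Qed.
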